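(* Let $n\ge2$, let $A\in GL(n,\mathbb Q)$ be an $n\times n$ dilation matrix with integer entries, let $|\det(A)|=d$, and suppose that $\{V_j\}_{j=0}^\infty$ is a projective multiresolution analysis for $\Xi$ corresponding to dilation by $A$. Suppose that $\{\Phi_1,\dots,\Phi_s\}$ is a module frame for $V_0$, and that $\{\Psi_1,\dots,\Psi_r\}$ is a module frame for the finitely generated projective $C(\mathbb T^n)$-module $W_0=V_1\ominus V_0$. Then it is possible to enumerate a countably infinite subset $\{v_l: l\ge0\}\subseteq\mathbb Z^n$ such that for each $i\in\mathbb N\cup\{0\}$, $\{v_l:0\le l\le d^i-1\}$ is a set of coset representatives for $\mathbb Z^n/A^i(\mathbb Z^n)$. Furthermore, letting $D$ be dilation by $A$ in the frequency domain, for each $i\in\mathbb N$ the set $$\{D^i\varepsilon_{v_l}(\Psi_k): 0\le l\le d^i-1,\ 1\le k\le r\}$$ forms a module frame for the finitely generated projective $C(\mathbb T^n)$-module $W_i=V_{i+1}\ominus V_i$, so that a module frame for all of $\Xi$ is given by $$\{\Phi_1,\dots,\Phi_s\}\ \cup\ \bigcup_{j=0}^\infty\bigcup_{k=1}^r\{D^j\varepsilon_{v_l}(\Psi_k): 0\le l\le d^j-1\}.$$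
   Context: Write $e(r)=e^{2\pi i r}$. Functions in $C(\mathbb T^n)$ are identified with continuous $\mathbb Z^n$-periodic functions on $\mathbb R^n$. An integer dilation matrix is an integer matrix all of whose eigenvalues have modulus strictly greater than $1$. $\Xi$ is the right Hilbert $C(\mathbb T^n)$-module obtained by completing $C_c(\mathbb R^n)$ with respect to the norm $\|\xi\|=\|\langle\xi,\xi\rangle_{C(\mathbb T^n)}\|_\infty^{1/2}$ determined by $\langle \xi,\eta\rangle_{C(\mathbb T^n)}(t)=\sum_{p\in\mathbb Z^n}(\overline{\xi}\eta)(t-p)$, with $C(\mathbb T^n)$ acting by pointwise multiplication; its elements are continuous functions on $\mathbb R^n$ and $\Xi\subseteq L^2(\mathbb R^n)$. $D=\mathcal F D_A\mathcal F^{*}$, where $D_A(\zeta)(x)=|\det A|^{1/2}\zeta(Ax)$ on $L^2(\mathbb R^n)$ and $\mathcal F(f)(x)=\int_{\mathbb R^n}f(t)e(-t\cdot x)\,dt$; explicitly $(D\xi)(x)=|\det A|^{-1/2}\xi((A^t)^{-1}x)$. For $v\in\mathbb Z^n$, $\varepsilon_v$ is the operator $(\varepsilon_v\xi)(t)=e(-v\cdot t)\xi(t)$. A sequence $\{V_j\}_{j\in\mathbb Z}$ of subspaces of $\Xi$ is a projective multiresolution analysis for dilation by $A$ if: (i) $V_0$ is a finitely generated projective $C(\mathbb T^n)$-submodule of $\Xi$; (ii) $V_j=D^j(V_0)$ for all $j$; (iii) $V_j\subset V_{j+1}$ for all $j\in\mathbb Z$; (iv) $\bigcup_{j\ge0}V_j$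 is dense in $\Xi$ in the Hilbert $C(\mathbb T^n)$-module norm; (v) $\bigcap_{j\in\mathbb Z}V_j=\{0\}$. (Here only the terms with $j\ge0$ are displayed.) $V_{i+1}\ominus V_i$ is the orthogonal complement of $V_i$ in $V_{i+1}$ with respect to the $C(\mathbb T^n)$-valued inner product. A finite or countable set $\{\psi_k\}$ in a Hilbert $C(\mathbb T^n)$-module $X$ is a module frame for $X$ if $\xi=\sum_k\psi_k\langle\psi_k,\xi\rangle_{C(\mathbb T^n)}$ for all $\xi\in X$, with convergence in the norm of $X$ (frames are treated as indexed families). *)

(* Defs.v *)
From HB Require Import structures.
From mathcomp Require Import all_boot all_order all_algebra.
From mathcomp Require Import finmap.
From mathcomp Require Import complex.
From mathcomp Require Import all_classical all_reals all_analysis.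
From mathcomp.analysis.showcase Require Import summability.

Set Implicit Arguments.
Unset Strict Implicit.
Unset Printing Implicit Defensive.
Import Order.TTheory GRing.Theory Num.Theory.
Import numFieldTopology.Exports numFieldNormedType.Exports.

Local Open Scope classical_set_scope.
Local Open Scope ring_scope.
Local Open Scope complex_scope.

Section HilbertModule.
Variables (R : realType) (n : nat).

(* Points of R^n are column vectors.  Functions R^n -> C form a commutative
   ring pointwise; the module action of C(T^n) is the product of this ring. *)
Notation F := ('cV[R]_n -> R[i]).
Implicit Types (xi eta f : F) (V X Y : set F).

Definition latt (p : 'cV[int]_n) : 'cV[R]_n := map_mx intr p.

(* e(r) = exp(2 pi i r) *)
Definition e (r : R) : R[i] := cos (2 * pi * r) +i* sin (2 * pi * r).

(* C(T^n), as the continuous Z^n-periodic functions on R^n *)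
Definition CT : set F :=
  [set f | continuous (f : 'cV[R]_n -> (R[i])^o) /\
           forall t p, f (t + latt p) = f t].

Definition Cc : set F :=
  [set f | continuous (f : 'cV[R]_n -> (R[i])^o) /\
           compact (closure [set t | f t != 0])].

(* [sum] is the unconditional sum (limit over finite subsets of Z^n); it is a
   junk value if the family is not summable, which does not happen on [Xi]. *)
Definition inner xi eta : F := fun t =>
  sum (fun p : 'cV[int]_n =>
    (conjc (xi (t - latt p)) * eta (t - latt p) : (R[i])^o)).

(* || <xi, xi> ||_oo ^ (1/2), with <xi, xi>(t) = \sum_p |xi(t - p)|^2 computed
   in [0, +oo] so that the norm of a function outside [Xi] is not junk. *)
Definition modnorm xi : \bar R :=
  (ereal_sup [set (\esum_(p in [set: 'cV[int]_n])
     ((Normc.normc (xi (t - latt p))) ^+ 2)%:E)%E | t in [set: 'cV[R]_n]]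
   `^ (2^-1))%E.

(* The completion of Cc, realised as a space of functions: the functions of
   finite [modnorm] form a Banach space, in which Xi is the closure of Cc. *)
Definition Xi : set F :=
  [set xi | forall eps : R, 0 < eps ->
     exists2 g, Cc g & (modnorm (xi - g)%R < eps%:E)%E].

Definition is_subspace X : Prop :=
  [/\ X `<=` Xi, X 0, forall xi eta, X xi -> X eta -> X (xi + eta)
    & forall (c : R[i]) xi, X xi -> X (xi * cst c)].

Definition is_submodule X : Prop :=
  [/\ X `<=` Xi, X 0, forall xi eta, X xi -> X eta -> X (xi + eta)
    & forall f xi, CT f -> X xi -> X (xi * f)].

(* C(T^n)-linear maps between subsets of the modules F and F^m *)
Definition CT_linear (M N : pzRingType) (emM : F -> M) (emN : F -> N)
    (P : set M) (Q : set N) (h : M -> N) : Prop :=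
  [/\ forall x, P x -> Q (h x),
      forall x y, P x -> P y -> h (x + y) = h x + h y
    & forall f x, CT f -> P x -> h (x * emM f) = h x * emN f].

Definition freeCT (m : nat) : set ('I_m -> F) :=
  [set a | forall k, CT (a k)].

(* Isomorphic to a direct summand of a free module C(T^n)^m: the map [iota]
   embeds X in C(T^n)^m and [rho] is a retraction of it. *)
Definition is_fg_projective X : Prop :=
  exists (m : nat) (iota : F -> ('I_m -> F)) (rho : ('I_m -> F) -> F),
    [/\ CT_linear id (fun f => cst f) X (@freeCT m) iota,
        CT_linear (fun f => cst f) id (@freeCT m) X rho
      & forall xi, X xi -> rho (iota xi) = xi].

(* V (-) U, for U a subset of V *)
Definition ominus V U : set F :=
  [set xi | V xi /\ forall eta, U eta -> inner eta xi = 0].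

(* Convergence is along the net of finite subsets of the index set. *)
Definition module_frame X (I : countType) (psi : I -> F) : Prop :=
  (forall k, X (psi k)) /\
  forall xi, X xi ->
    modnorm (xi - partial_sum (fun k => psi k * inner (psi k) xi) J)
      @[J --> @totally I] --> (0 : \bar R)%E.

Definition eps_op (v : 'cV[int]_n) xi : F :=
  fun t => e (- ((latt v)^T *m t) 0 0) * xi t.

Variable A : 'M[int]_n.

Definition realmx : 'M[R]_n := map_mx intr A.

Definition is_dilation : Prop :=
  forall z : R[i], eigenvalue (map_mx intr A) z -> 1 < `|z|.

Definition sqrtdet : R := Num.sqrt `|\det realmx|.

Definition dil xi : F :=
  fun x => (sqrtdet^-1)%:C * xi (invmx realmx^T *m x).

(* the inverse of [dil], see [dilK] and [dil_invK] below *)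
Definition dil_inv xi : F :=
  fun x => sqrtdet%:C * xi (realmx^T *m x).

Definition dilz (j : int) : F -> F :=
  match j with
  | Posz k => iter k dil
  | Negz k => iter k.+1 dil_inv
  end.

Lemma dilK : \det A != 0 -> cancel dil dil_inv.
Proof.
move=> dA xi; apply/funext => x; rewrite /dil /dil_inv.
have dR : \det realmx != 0 by rewrite det_map_mx intr_eq0.
have uR : realmx^T \in unitmx by rewrite unitmx_tr unitmxE unitfE.
have s0 : sqrtdet != 0 by rewrite sqrtr_eq0 -ltNge normr_gt0.
by rewrite mulKmx // mulrA -rmorphM mulfV // rmorph1 mul1r.
Qed.

Lemma dil_invK : \det A != 0 -> cancel dil_inv dil.
Proof.
move=> dA xi; apply/funext => x; rewrite /dil /dil_inv.
have dR : \det realmx != 0 by rewrite det_map_mx intr_eq0.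
have uR : realmx^T \in unitmx by rewrite unitmx_tr unitmxE unitfE.
have s0 : sqrtdet != 0 by rewrite sqrtr_eq0 -ltNge normr_gt0.
by rewrite mulKVmx // mulrA -rmorphM mulVf // rmorph1 mul1r.
Qed.

Record is_pmra (V : int -> set F) : Prop := {
  pmra_subspace : forall j, is_subspace (V j);
  pmra_submodule0 : is_submodule (V 0);
  pmra_projective0 : is_fg_projective (V 0);
  pmra_dil : forall j, V j = dilz j @` V 0;
  pmra_incl : forall j, V j `<=` V (j + 1);
  pmra_dense : forall xi, Xi xi -> forall eps : R, 0 < eps ->
    exists (j : nat) eta, V j%:Z eta /\ (modnorm (xi - eta)%R < eps%:E)%E;
  pmra_cap : \bigcap_j V j = [set 0]
}.

Definition wavelet_space (V : int -> set F) (i : nat) : set F :=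
  ominus (V i.+1%:Z) (V i%:Z).

(* {v_l : l < d^i} is a set of representatives of Z^n / A^i Z^n *)
Definition coset_reps (d i : nat) (v : nat -> 'cV[int]_n) : Prop :=
  forall z : 'cV[int]_n, exists! l : 'I_(d ^ i),
    exists w : 'cV[int]_n, z = v l + (A ^+ i) *m w.

Definition level_family (d r : nat) (v : nat -> 'cV[int]_n)
    (Psi : 'I_r -> F) (i : nat) (lk : 'I_(d ^ i) * 'I_r) : F :=
  dilz i%:Z (eps_op (v lk.1) (Psi lk.2)).

Definition full_family (d s r : nat) (v : nat -> 'cV[int]_n)
    (Phi : 'I_s -> F) (Psi : 'I_r -> F)
    (x : 'I_s + {j : nat & ('I_(d ^ j) * 'I_r)%type}) : F :=
  match x with
  | inl k => Phi k
  | inr (existT j lk) => level_family v Psi lk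
  end.

End HilbertModule.

(* Main.v *)
Require Import Defs.
From mathcomp Require Import all_boot all_order all_algebra.
From mathcomp Require Import finmap complex.
From mathcomp Require Import all_classical all_reals all_analysis.
From mathcomp.analysis.showcase Require Import summability.
From mathcomp Require Import ring lra zify.

(* Write T for the i-th power of the dilation D, B for the transpose of A^i and
   N = d^i.  For representatives v_l of Z^n / A^i Z^n, the characters
   v |-> e(-v . B^-1 p) of this finite group sum to N if p lies in B Z^n and to
   0 otherwise.  Expanding the inner products over Z^n, this gives
     sum_l e(-v_l . B^-1 t) <T(eps_{v_l} eta), T xi>(t) = <eta, xi>(B^-1 t).
   With eta = Psi_k it turns the reconstruction formula of W_0 into that of
   T W_0, and it shows that orthogonality of T xi to V_i = T V_0 forces that of
   xi to V_0, so that W_i = T W_0.  The v_l are the base-d expansions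
   sum_k A^k w_(digit k of l) over representatives w of Z^n / A Z^n, w_0 = 0.

   Frames of V_0, W_0, ..., W_(m-1) together reconstruct V_m, because the error
   of the partial reconstruction is orthogonal to V_m.  Hence Bessel's
   inequality holds at each point t, every finite partial sum S_J of the full
   family satisfies <S_J xi, S_J xi>(t) <= <xi, xi>(t), and the density of the
   V_m yields convergence on all of Xi.  All Hilbert module estimates are made
   pointwise in t, in the l^2-space of the translates of t by Z^n. *)

Set Implicit Arguments.
Unset Strict Implicit.
Unset Printing Implicit Defensive.
Import Order.TTheory GRing.Theory Num.Theory.
Import numFieldTopology.Exports numFieldNormedType.Exports.

Local Open Scope classical_set_scope.
Local Open Scope ring_scope.
Local Open Scope complex_scope.

(** * Unconditional sums of complex families *)

#[local] Existing Instance totally_filter.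

Section HasSum.
Variables (R : realType) (I : choiceType).
Implicit Types (f g : I -> R[i]) (s : R[i]).

(** A relation with the value as argument, so that it also records summability, whereas
    [summability.sum] has a default value on other families. *)
Definition has_sum f s : Prop :=
  partial_sum (fun i => (f i : (R[i])^o)) A @[A --> @totally I] --> (s : (R[i])^o).

Lemma partial_sumE f (B : {fset I}) : partial_sum f B = \sum_(i <- B) f i.
Proof. by rewrite /partial_sum big_seq_fsetE. Qed.

(** The norm of [R[i]] takes its values in [R[i]]; this passes to the real-valued modulus, where
    real arithmetic applies. *)
Lemma norm_normc (z : R[i]) : `|z| = (Normc.normc z)%:C.
Proof. by case: z. Qed.

Lemma has_sumP f s : has_sum f s <->
  forall eps : R, 0 < eps -> exists A : {fset I}, forall B : {fset I},
    (A `<=` B)%fset -> `|s - \sum_(i <- B) f i| < eps%:C.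
Proof.
split.
  move=> /cvgrPdist_lt fs eps e0.
  have e0' : 0 < eps%:C by rewrite ltcR.
  have [A _ HA] := fs _ e0'.
  by exists A => B AB; have := HA B AB; rewrite /= partial_sumE.
(* A positive element of [R[i]] has zero imaginary part, so only real tolerances occur. *)
move=> fs; apply/cvgrPdist_lt => eps; case: eps => a b; rewrite ltcE /=.
move=> /andP[/eqP -> a0]; have [A HA] := fs a a0.
by exists A => // B AB; rewrite /= partial_sumE; exact: HA.
Qed.

Lemma has_sum_unique f s t : has_sum f s -> has_sum f t -> s = t.
Proof.
move=> fs ft.
exact: (cvg_unique (@norm_hausdorff _ (R[i])^o) fs ft).
Qed.

Lemma has_sumE f s : has_sum f s -> summability.sum (fun i => (f i : (R[i])^o)) = s.
Proof. by move=> fs; exact: (cvg_lim (@norm_hausdorff _ (R[i])^o) fs). Qed.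

Lemma eq_has_sum f g s : f =1 g -> has_sum f s -> has_sum g s.
Proof. by move=> /funext ->. Qed.

Lemma has_sumD f g s t : has_sum f s -> has_sum g t ->
  has_sum (fun i => f i + g i) (s + t).
Proof.
rewrite /has_sum => fs gt.
rewrite (_ : (fun A => _) = (fun A => partial_sum (fun i => (f i : (R[i])^o)) A +
  partial_sum (fun i => (g i : (R[i])^o)) A)); first exact: cvgD fs gt.
by apply/funext => B; rewrite /partial_sum -big_split.
Qed.

Lemma has_sumZ f s c : has_sum f s -> has_sum (fun i => c * f i) (c * s).
Proof.
rewrite /has_sum => fs.
rewrite (_ : (fun A => _) =
  (fun A => c * partial_sum (fun i => (f i : (R[i])^o)) A)).
  exact: cvgMl_tmp fs.
by apply/funext => B; rewrite /partial_sum mulr_sumr.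
Qed.

Lemma has_sum0 : has_sum (fun=> 0) 0.
Proof.
apply/has_sumP => eps e0; exists fset0 => B _.
by rewrite big1 // subrr normr0 ltcR.
Qed.

Lemma has_sum_bigD (L : Type) (r : seq L) (f : L -> I -> R[i]) (s : L -> R[i]) :
  (forall l, has_sum (f l) (s l)) ->
  has_sum (fun i => \sum_(l <- r) f l i) (\sum_(l <- r) s l).
Proof.
move=> fs; elim: r => [|l r IH].
  by rewrite big_nil; apply: eq_has_sum has_sum0 => i; rewrite big_nil.
rewrite big_cons; apply: eq_has_sum (has_sumD (fs l) IH) => i.
by rewrite big_cons.
Qed.

Lemma has_sum_conj f s : has_sum f s -> has_sum (fun i => conjc (f i)) (conjc s).
Proof.
move=> /has_sumP fs; apply/has_sumP => eps e0; have [A HA] := fs _ e0.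
by exists A => B /HA; rewrite -raddf_sum -raddfB normcJ.
Qed.

Lemma ler_sum_fset (g : I -> R) (A B : {fset I}) : (forall i, 0 <= g i) ->
  (A `<=` B)%fset -> \sum_(i <- A) g i <= \sum_(i <- B) g i.
Proof.
move=> g0 AB; rewrite [leRHS](big_fsetID _ (mem A)) /=.
rewrite [X in _ <= X + _](_ : _ = \sum_(i <- A) g i) ?lerDl ?sumr_ge0 //.
apply: eq_fbigl => i; rewrite !inE /=.
by case: (boolP (i \in A)) => [/(fsubsetP AB)->|]; rewrite ?andbF.
Qed.

(** The sum is the supremum of the finite partial sums, which grow with the finite set. *)
Lemma has_sum_ge0 (g : I -> R) (M : R) : (forall i, 0 <= g i) ->
  (forall B : {fset I}, \sum_(i <- B) g i <= M) ->
  exists s : R, [/\ has_sum (fun i => (g i)%:C) s%:C, s <= M &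
    forall B : {fset I}, \sum_(i <- B) g i <= s].
Proof.
move=> g0 gM; pose S := [set \sum_(i <- (B : {fset I})) g i | B in [set: {fset I}]].
have Sub : ubound S M by move=> _ [B _ <-].
have Ssup : has_sup S.
  by split; [exists 0, fset0 => //; rewrite big_seq_fset0 | exists M].
have gS (B : {fset I}) : \sum_(i <- B) g i <= sup S.
  by apply: sup_upper_bound => //; exists B.
exists (sup S); split => //.
- apply/has_sumP => eps e0.
  have [_ [A _ <-] HA] := sup_adherent e0 Ssup.
  exists A => B AB; rewrite -raddf_sum -raddfB /= norm_normc ltcR /=.
  rewrite expr0n addr0 sqrtr_sqr ger0_norm ?subr_ge0 //.
  rewrite ltrBlDr -ltrBlDl (lt_le_trans HA) //.
  exact: ler_sum_fset.
- by apply: ge_sup => //; exists 0, fset0 => //; rewrite big_seq_fset0.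
Qed.

Lemma has_sum_ub (g : I -> R) (s : R) : (forall i, 0 <= g i) ->
  has_sum (fun i => (g i)%:C) s%:C -> forall B : {fset I}, \sum_(i <- B) g i <= s.
Proof.
move=> g0 /has_sumP gs B; rewrite leNgt; apply/negP => sB.
have e0 : 0 < \sum_(i <- B) g i - s by rewrite subr_gt0.
have [A /(_ (A `|` B)%fset (fsubsetUl _ _))] := gs _ e0.
rewrite -raddf_sum -raddfB /= norm_normc ltcR /= expr0n addr0 sqrtr_sqr distrC.
have le : \sum_(i <- B) g i <= \sum_(i <- (A `|` B)%fset) g i.
  exact/ler_sum_fset/fsubsetUr.
rewrite ger0_norm ?subr_ge0; last exact: le_trans (ltW sB) le.
by rewrite ltNge lerD2r le.
Qed.

Lemma has_sum_dom f (g : I -> R) (s : R) : (forall i, `|f i| <= (g i)%:C) ->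
  has_sum (fun i => (g i)%:C) s%:C -> exists2 z, has_sum f z & `|z| <= s%:C.
Proof.
move=> fg gs.
have g0 i : 0 <= g i by rewrite -ler0c (le_trans _ (fg i)).
have ubg := has_sum_ub g0 gs.
(* Adding [g] to a real family dominated by [g] makes it nonnegative. *)
have bd (h : I -> R) : (forall i, `|h i| <= g i) ->
    exists a : R, has_sum (fun i => (h i)%:C) a%:C.
  move=> hg; have [||a [hs _ _]] := @has_sum_ge0 (fun i => h i + g i) (s + s).
  - by move=> i; have := hg i; rewrite ler_norml => /andP[]; lra.
  - move=> B; rewrite big_split /= lerD //.
    apply: le_trans (ubg B); apply: ler_sum => i _.
    exact: le_trans (ler_norm _) (hg i).
  exists (a - s); have := has_sumD hs (has_sumZ (c := -1) gs).
  rewrite mulN1r -raddfB /=; apply: eq_has_sum => i.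
  by rewrite mulN1r raddfD addrK.
have [a fa] : exists a : R, has_sum (fun i => (complex.Re (f i))%:C) a%:C.
  by apply: bd => i; rewrite -lecR (le_trans _ (fg i)) // normc_ge_Re.
have [b fb] : exists b : R, has_sum (fun i => (complex.Im (f i))%:C) b%:C.
  apply: bd => i; rewrite -lecR (le_trans _ (fg i)) //.
  (* Up to sign the imaginary part is the real part of [f i * 'i], which has the same modulus. *)
  have := normc_ge_Re (f i * 'i%C); rewrite ReiNIm normrN normrM.
  by rewrite [X in _ * X]normc_def /= expr0n add0r expr1n sqrtr1 mulr1.
have [z fz] : exists z, has_sum f z.
  eexists; apply: eq_has_sum (has_sumD fa (has_sumZ (c := 'i%C) fb)) => i.
  by rewrite -complexE.
exists z => //.
(* Finite partial sums obey the bound, and some of them are within [eps] of the limit. *)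
rewrite norm_normc lecR; apply/ler_addgt0Pr => eps e0.
move/has_sumP : fz => /(_ _ e0)[A /(_ A (fsubset_refl _)) fA].
rewrite -lecR -norm_normc -[z](subrK (\sum_(i <- A) f i)).
apply: le_trans (ler_normD _ _) _.
rewrite addrC raddfD /= lerD //; last exact: ltW.
apply: le_trans (ler_norm_sum _ _ _) _.
apply: le_trans (_ : (\sum_(i <- A) g i)%:C <= _); last by rewrite lecR.
by rewrite raddf_sum; apply: ler_sum.
Qed.

End HasSum.

(** A finite set of indices may be replaced by its preimage under [h], finite by injectivity: the
    indices lost carry zero terms. Used for translations and for passing to a sublattice. *)
Lemma has_sum_inj (R : realType) (I J : choiceType) (h : J -> I) (f : I -> R[i]) s :
  injective h -> (forall i, ~ range h i -> f i = 0) ->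
  has_sum (fun j => f (h j)) s -> has_sum f s.
Proof.
move=> hi f0 /has_sumP fs; apply/has_sumP => eps /fs[A HA].
exists (h @` A)%fset => B AB.
have finB : finite_set (h @^-1` [set` B]).
  by apply: finite_preimage; [move=> x y _ _; exact: hi|exact: finite_fset].
pose C := fset_set (h @^-1` [set` B]).
have inC j : (j \in C) = (h j \in B)
  by rewrite in_fset_set //; apply/idP/idP => [/set_mem|] // ?; exact/mem_set.
have AC : (A `<=` C)%fset.
  by apply/fsubsetP => j jA; rewrite inC (fsubsetP AB) // in_imfset.
rewrite (_ : \sum_(i <- B) f i = \sum_(j <- C) f (h j)); first exact: HA.
have -> : \sum_(j <- C) f (h j) = \sum_(i <- (h @` C)%fset) f i.
  by rewrite big_imfset //= => x y _ _; exact: hi.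
apply/esym/big_fset_incl.
  by apply/fsubsetP => i /imfsetP[j /=]; rewrite inC => hB ->.
move=> i iB /imfsetP iC; apply: f0 => -[j _ ji]; apply: iC.
by exists j => //=; rewrite inC ji.
Qed.

(** * Nested coset representatives *)

Section Lattice.
Variable n : nat.
Implicit Types (A M : 'M[int]_n) (v w : nat -> 'cV[int]_n).

(** The content of [coset_reps] with existence and uniqueness split and plain natural numbers as
    indices, so that one sequence can serve all levels. *)
Definition repr_sys M (N : nat) v : Prop :=
  (forall z, exists2 l, (l < N)%N & exists y, z = v l + M *m y) /\
  (forall l l' y, (l < N)%N -> (l' < N)%N -> v l = v l' + M *m y -> l = l').

(** [M] need not be invertible over the integers; multiplication by the adjugate turns it into the
    nonzero scalar [\det M], which cancels. *)
Lemma mulmx_int_inj M m : \det M != 0 -> injective (mulmx M : 'M[int]_(n, m) -> _).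
Proof.
move=> dM x y /(congr1 (mulmx (\adj M))); rewrite !mulmxA !mul_adj_mx.
rewrite !mul_scalar_mx => xy; apply/matrixP => i j.
by have /matrixP/(_ i j) := xy; rewrite !mxE => /(mulfI dM).
Qed.

(** In a Smith form [A = L D Q] with [L], [Q] unimodular, the image of [A] is that of [L D].
    Representatives are thus [L c] with [c] in the box [0 <= c_i < |d_i|], which has [|\det A|]
    points. *)
Lemma repr_sys_smith A : \det A != 0 -> exists v, repr_sys A `|\det A|%N v.
Proof.
move=> dA; have [L uL [Q uQ [d _ defA]]] := int_Smith_normal_form A.
pose D : 'M[int]_n := \matrix_(i, j) (d`_i *+ (i == j :> nat)).
have defD : D = diag_mx (\row_i d`_i).
  by apply/matrixP => i j; rewrite !mxE.
have detA : `|\det A|%N = (\prod_(i < n) `|(d`_i)%R|)%N.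
  rewrite defA -/D !det_mulmx !abszM defD det_diag.
  have abs1 (U : 'M[int]_n) : U \in unitmx -> `|\det U|%N = 1%N.
    by rewrite unitmxE => /orP[]/eqP ->.
  rewrite !abs1 // mul1n muln1 (big_morph _ abszM (erefl : `|1%R|%N = 1%N)).
  by apply: eq_bigr => i _; rewrite mxE.
have d0 i : (i < n)%N -> d`_i != 0.
  move=> lt_in; rewrite -absz_eq0 -lt0n.
  have : (0 < \prod_(i < n) `|(d`_i)%R|)%N by rewrite -detA lt0n absz_eq0.
  by rewrite (bigD1 (Ordinal lt_in)) //= muln_gt0 => /andP[].
(* [N] merely bounds all box sides, to give the coordinates one common finite type. *)
pose N := (\max_(i < n) `|(d`_i)%R|)%N.
pose box (i : 'I_n) := [pred x : 'I_N.+1 | (x < `|(d`_i)%R|)%N].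
pose s := enum (family box : simpl_pred {ffun 'I_n -> 'I_N.+1}).
have sz_s : size s = `|\det A|%N.
  rewrite detA -cardE card_family foldrE big_map big_enum /=.
  apply: eq_bigr => i _; rewrite -sum1_card.
  rewrite -(big_ord_widen N.+1 (fun=> 1%N)) ?sum1_card ?card_ord //.
  exact/leqW/(leq_bigmax i).
pose f0 : {ffun 'I_n -> 'I_N.+1} := [ffun=> ord0].
have in_s l i : (l < `|\det A|)%N -> (nth f0 s l i < `|(d`_i)%R|)%N.
  rewrite -sz_s => /(mem_nth f0); rewrite mem_enum => /familyP/(_ i).
  by rewrite inE.
pose c l : 'cV[int]_n := \col_i ((nth f0 s l i : nat) : int).
exists (fun l => L *m c l); split.
(* In the coordinates [y] of [z] along [L], division by the [d_i] leaves remainders in the box. *)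
- move=> z; have [y yE] : exists y, y = invmx L *m z by exists (invmx L *m z).
  have lt_mod (i : 'I_n) : (`|(y i ord0 %% d`_i)%Z| < `|(d`_i)%R|)%N.
    by rewrite -ltz_nat gez0_abs ?modz_ge0 ?d0 // abszE ltz_mod ?d0.
  have le_N (i : 'I_n) : (`|(d`_i)%R| <= N)%N by apply: (leq_bigmax i).
  pose f : {ffun 'I_n -> 'I_N.+1} := [ffun i => inord `|(y i ord0 %% d`_i)%Z|].
  have fE i : f i = `|(y i ord0 %% d`_i)%Z|%N :> nat.
    by rewrite ffunE inordK // ltnS (leq_trans (ltnW (lt_mod i))).
  have fs : f \in s.
    by rewrite mem_enum; apply/familyP => i; rewrite inE fE.
  exists (index f s); first by rewrite -sz_s index_mem.
  exists (invmx Q *m \col_i (y i ord0 %/ d`_i)%Z).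
  rewrite defA -/D -!mulmxA mulKVmx // -mulmxDr -[LHS](mulKVmx uL) -yE.
  congr (_ *m _); apply/colP => i; rewrite defD mul_diag_mx !mxE nth_index // fE.
  by rewrite gez0_abs ?modz_ge0 ?d0 // mulrC addrC -divz_eq.
- move=> l l' y ld ld' eqv.
  have [x {}eqv] : exists x, c l = c l' + D *m x.
    exists (Q *m y); apply: (can_inj (mulKmx uL)); rewrite mulmxDr eqv defA -/D.
    by rewrite !mulmxA.
  suff : nth f0 s l = nth f0 s l'.
    by move/eqP; rewrite nth_uniq ?enum_uniq ?sz_s // => /eqP.
  apply/ffunP => i; apply/val_inj => /=.
  have := in_s l i ld; have := in_s l' i ld'.
  have /colP/(_ i) := eqv; rewrite defD mul_diag_mx !mxE.
  set a : nat := nth f0 s l i; set b : nat := nth f0 s l' i.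
  move: (d`_i) (x i ord0) => e q abq lb la.
  (* Two coordinates in [[0, |e|)] differ by the multiple [e * q], which forces [q = 0]. *)
  have [q0|] := eqVneq q 0; first by move: abq; rewrite q0; lia.
  move=> q0; have : (`|(e * q)%R| < `|e|)%N by lia.
  rewrite abszM; have : (0 < `|q|)%N by rewrite lt0n absz_eq0.
  by nia.
Qed.

(** Horner form of the expansion with [i] digits, least significant digit first. *)
Fixpoint digit_sum A (d : nat) (w : nat -> 'cV[int]_n) (i l : nat) : 'cV[int]_n :=
  if i is i'.+1 then w (l %% d)%N + A *m digit_sum A d w i' (l %/ d)%N else 0.

(** Write [z = w_a + A z'] and expand [z'] with [i] digits: the index is [a + b * d]. Conversely the
    residue modulo [A] fixes the lowest digit, and cancelling [A] leaves the case of [i] digits. *)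
Lemma repr_sys_digit_sum A d w i : (0 < d)%N -> \det A != 0 ->
  repr_sys A d w -> repr_sys (A ^+ i) (d ^ i) (digit_sum A d w i).
Proof.
move=> d0 dA [wex wuniq]; elim: i => [|i [IHex IHuniq]].
  split=> [z|[|l] [|l'] //]; rewrite expr0.
  by exists 0%N => //; exists z; rewrite add0r mul1mx.
split=> [z|l l' y ld ld' /=].
  have [a ad [z' ->]] := wex z; have [b bd [y ->]] := IHex z'.
  exists (a + b * d)%N; first by rewrite expnSr; nia.
  exists y; rewrite /= addnC modnMDl divnMDl // modn_small // divn_small // addn0.
  by rewrite mulmxDr exprS -mulmxE mulmxA addrA.
rewrite exprS -mulmxE -mulmxA -addrA -mulmxDr => eqv.
have dpos k : (k %% d < d)%N by rewrite ltn_mod.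
have := wuniq _ _ (digit_sum A d w i (l' %/ d) + A ^+ i *m y
  - digit_sum A d w i (l %/ d)) (dpos l) (dpos l').
rewrite mulmxBr addrA -eqv addrK => /(_ erefl) eqm.
move: eqv; rewrite eqm => /addrI /(mulmx_int_inj dA).
move=> /IHuniq eqd; rewrite (divn_eq l d) (divn_eq l' d) eqm eqd //.
  by rewrite ltn_divLR // -expnSr.
by rewrite ltn_divLR // -expnSr.
Qed.

(** An index below [d ^ i] has leading digit 0, which contributes nothing since [w 0 = 0]. This
    makes the systems of all levels nested. *)
Lemma digit_sum_stable A d w i l : w 0%N = 0 -> (l < d ^ i)%N ->
  digit_sum A d w i.+1 l = digit_sum A d w i l.
Proof.
move=> w0; elim: i l => [|i IH] l.
  by rewrite expn0 ltnS leqn0 => /eqP -> /=; rewrite mod0n w0 mulmx0 addr0.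
case: d IH => [|d] IH; first by rewrite exp0n.
by rewrite expnSr -ltn_divLR // => /IH /= ->.
Qed.

Lemma digit_sum_stableD A d w i k l : w 0%N = 0 -> (1 < d)%N -> (l < d ^ i)%N ->
  digit_sum A d w (i + k) l = digit_sum A d w i l.
Proof.
move=> w0 d1 li; elim: k => [|k IH]; first by rewrite addn0.
by rewrite addnS digit_sum_stable ?IH // (leq_trans li) // leq_exp2l // leq_addr.
Qed.

Lemma exists_nested_reprs A (d : nat) : (1 < d)%N -> d = `|\det A|%N ->
  exists v, injective v /\ forall i, repr_sys (A ^+ i) (d ^ i) v.
Proof.
move=> d1 dE; have dA : \det A != 0 by rewrite -absz_eq0 -dE; case: d d1 {dE}.
have [w [wex wuniq]] := repr_sys_smith dA; rewrite -dE in wex wuniq.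
(* Translating all representatives by one vector keeps them representatives and makes the zeroth one
   vanish. *)
pose u l := w l - w 0%N.
have ru : repr_sys A d u.
  split=> [z|l l' y ld ld' uE].
    have [l ld [y zE]] := wex (z + w 0%N); exists l => //; exists y.
    by rewrite /u addrAC -zE addrK.
  by apply: (wuniq l l' y) => //; rewrite -[LHS](subrK (w 0%N)) -/(u l) uE addrAC subrK.
have u0 : u 0%N = 0 by rewrite /u subrr.
have lt_exp l : (l < d ^ l)%N by rewrite ltn_expl.
(* Since [l < d ^ l], already [l] digits suffice for the index [l], and any other sufficient number
   gives the same vector. *)
pose v l := digit_sum A d u l l.
have vE i l : (l < d ^ i)%N -> v l = digit_sum A d u i l.
  move=> li; have [/subnKC il|/ltnW/subnKC il] := leqP i l.
    by rewrite /v -[X in digit_sum _ _ _ X]il digit_sum_stableD.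
  by rewrite -il digit_sum_stableD.
have rv i := repr_sys_digit_sum i (ltnW d1) dA ru.
exists v; split=> [l l' vll'|i].
  (* Two indices lie in a common level, whose representatives are distinct. *)
  have ll : (l < d ^ maxn l l')%N.
    by rewrite (leq_trans (lt_exp l)) // leq_exp2l // leq_maxl.
  have ll' : (l' < d ^ maxn l l')%N.
    by rewrite (leq_trans (lt_exp l')) // leq_exp2l // leq_maxr.
  apply: ((rv (maxn l l')).2 l l' 0) => //.
  by rewrite mulmx0 addr0 -!vE ?vll'.
split=> [z|l l' y li li'].
  have [l li [y ->]] := (rv i).1 z.
  by exists l => //; exists y; rewrite (vE i).
by rewrite !(vE i) //; exact: (rv i).2.
Qed.

Lemma repr_sys_coset_reps A d i v : repr_sys (A ^+ i) (d ^ i) v ->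
  coset_reps A d i v.
Proof.
move=> [vex vuniq] z; have [l li [y ->]] := vex z.
exists (Ordinal li); split; first by exists y.
move=> l' [y' vE]; apply/val_inj/(vuniq _ _ (y' - y)) => //=.
by rewrite mulmxBr addrA -vE addrK.
Qed.

End Lattice.

(** Up to sign, the determinant is the constant coefficient of the characteristic polynomial, hence
    a product of [n > 0] eigenvalues of modulus greater than 1. *)
Lemma dilation_det_gt1 (R : rcfType) n (A : 'M[int]_n) : (0 < n)%N ->
  (forall z : R[i], eigenvalue (map_mx intr A) z -> 1 < `|z|) ->
  (1 < `|\det A|)%N.
Proof.
move=> n0 hA; pose C : 'M[R[i]]_n := map_mx intr A.
have [r pE] := closed_field_poly_normal (char_poly C).
rewrite (monicP (char_poly_monic C)) scale1r in pE.
have szr : size r = n.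
  by have := size_char_poly C; rewrite pE size_prod_XsubC => -[].
have gt1 : 1 < \prod_(z <- r) `|z|.
  have r1 : all (fun z => 1 < `|z|) r.
    apply/allP => z zr; apply: hA; rewrite eigenvalue_root_char pE root_prod_XsubC //.
  case: r szr r1 {pE} => [|z r _ /= /andP[z1 r1]]; first by move=> e; rewrite -e in n0.
  rewrite big_cons (lt_le_trans z1) // ler_peMr ?normr_ge0 //.
  elim: r r1 => [|y r IH] /=; first by rewrite big_nil.
  by move=> /andP[y1 /IH r1]; rewrite big_cons mulr_ege1 // ltW.
have : `|(char_poly C)`_0| = \prod_(z <- r) `|z|.
  rewrite -horner_coef0 pE horner_prod normr_prod; apply: eq_bigr => z _.
  by rewrite hornerXsubC sub0r normrN.
rewrite char_poly_det normrM normrX normrN1 expr1n mul1r det_map_mx => e.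
by move: gt1; rewrite -e -intr_norm -abszE -[1]/(1%:~R) ltr_int ltz_nat.
Qed.

(** * Characters of the lattice quotients *)

Section Characters.
Variable R : realType.

Lemma eD (x y : R) : e (x + y) = e x * e y.
Proof.
apply/eqP; rewrite /e eq_complex /= mulrDr cosD sinD.
by rewrite [X in _ && (X == _)]addrC !eqxx.
Qed.

Lemma e0 : e (0 : R) = 1.
Proof. by rewrite /e mulr0 cos0 sin0. Qed.

Lemma eN (x : R) : e (- x) = conjc (e x).
Proof. by rewrite /e mulrN cosN sinN. Qed.

Lemma e_nat (k : nat) : e (k%:R : R) = 1.
Proof.
elim: k => [|k IH]; first exact: e0.
rewrite -addn1 natrD eD IH mul1r /e mulr1.
by rewrite mulrC -mulr_natr mul1r mulr_natr cos2pi sin2pi.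
Qed.

Lemma e_int (k : int) : e (k%:~R : R) = 1.
Proof.
case: k => k; first by rewrite -pmulrn e_nat.
by rewrite NegzE mulrNz -pmulrn eN e_nat conjc1.
Qed.

(** Subtracting the floor leaves [s] in [[0, 1)]. From [cos (2 pi s) = 1 - 2 sin (pi s) ^ 2 = 1] the
    sine vanishes, whereas it is positive for [0 < s < 1]. *)
Lemma e_eq1 (x : R) : e x = 1 -> exists k : int, x = k%:~R.
Proof.
pose k := Num.floor x; pose s := x - k%:~R => ex.
have es : e s = 1 by rewrite /s eD eN e_int conjc1 mulr1.
have s0 : 0 <= s by rewrite subr_ge0 Num.Theory.floor_le_tmp.
have s1 : s < 1 by rewrite ltrBlDl; have := floorD1_gt x; rewrite intrD.
exists k; apply/eqP; rewrite -subr_eq0 -/s; apply/negP => /negP sn0.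
have sp : 0 < sin (pi * s).
  by apply: sin_gt0_pi; rewrite ?mulr_gt0 ?pi_gt0 ?lt0r ?sn0 // gtr_pMr ?pi_gt0.
have : cos (2 * pi * s) = 1 by case: es.
rewrite -mulrA mulr_natl cos_mulr2n cos2sin2 => c1.
have : sin (pi * s) ^+ 2 = 0 by move: c1; rewrite mulr2n; lra.
by move/eqP; rewrite sqrf_eq0 gt_eqF.
Qed.

End Characters.

Section CharacterSum.
Variables (R : realType) (n : nat).
Implicit Types (p q : 'cV[int]_n) (t u : 'cV[R]_n).

(** Translation by [z] permutes the cosets, so multiplication by [chi z] fixes the sum; as [chi z]
    is not 1, the sum is 0. *)
Lemma char_sum_repr (M : 'M[int]_n) N v (chi : 'cV[int]_n -> R[i]) z :
  repr_sys M N v -> (forall a b, chi (a + b) = chi a * chi b) ->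
  (forall y, chi (M *m y) = 1) -> chi z != 1 -> \sum_(l < N) chi (v l) = 0.
Proof.
move=> [vex vuniq] chiD chiM chiz.
have /choice[f fE] : forall l : 'I_N, exists l' : 'I_N,
    exists y, v l + z = v l' + M *m y.
  by move=> l; have [l' l'N [y E]] := vex (v l + z); exists (Ordinal l'N), y.
have f_inj : injective f.
  move=> l l' ff; have [y Ey] := fE l; have [y' Ey'] := fE l'.
  apply/val_inj/(vuniq _ _ (y - y') (ltn_ord l) (ltn_ord l')).
  apply: (addIr z); rewrite Ey addrAC Ey' ff mulmxBr.
  by rewrite -addrA [M *m y' + _]addrC subrK.
have S : chi z * \sum_(l < N) chi (v l) = \sum_(l < N) chi (v l).
  rewrite [RHS](reindex_inj f_inj) mulr_sumr; apply: eq_bigr => l _.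
  by have [y Ey] := fE l; rewrite mulrC -chiD Ey chiD chiM mulr1.
apply/eqP; move/eqP: S; rewrite -subr_eq0 -[X in _ - X]mul1r -mulrBl mulf_eq0.
by rewrite subr_eq0 (negbTE chiz).
Qed.

Definition pairing p t : R := ((latt R p)^T *m t) 0 0.

Lemma lattD p q : latt R (p + q) = latt R p + latt R q.
Proof. exact: map_mxD. Qed.

Lemma lattM (M : 'M[int]_n) p : latt R (M *m p) = Defs.realmx R M *m latt R p.
Proof. exact: map_mxM. Qed.

Lemma latt_inj : injective (@latt R n).
Proof.
move=> p q pq; apply/colP => i; have /colP/(_ i) := pq; rewrite !mxE.
exact: intr_inj.
Qed.

Lemma pairingDl p q t : pairing (p + q) t = pairing p t + pairing q t.
Proof. by rewrite /pairing lattD linearD mulmxDl mxE. Qed.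

Lemma pairingDr p t u : pairing p (t + u) = pairing p t + pairing p u.
Proof. by rewrite /pairing mulmxDr mxE. Qed.

Lemma pairingNr p t : pairing p (- t) = - pairing p t.
Proof. by rewrite /pairing mulmxN mxE. Qed.

Lemma pairing_latt q p : exists k : int, pairing q (latt R p) = k%:~R.
Proof.
exists ((q^T *m p) 0 0).
by rewrite /pairing /latt map_trmx -map_mxM mxE.
Qed.

Lemma pairing_delta i t : pairing (delta_mx i 0) t = t i 0.
Proof.
by rewrite /pairing /latt map_delta_mx trmx_delta -rowE mxE.
Qed.

Variables (M : 'M[int]_n) (N : nat) (v : nat -> 'cV[int]_n).
Hypotheses (dM : \det M != 0) (vM : repr_sys M N v).

Lemma realmx_unit : Defs.realmx R M \in unitmx.
Proof. by rewrite unitmxE unitfE det_map_mx intr_eq0. Qed.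

(** The character is trivial on the image of [M], because [M y] paired with the inverse transpose
    applied to [p] is the integer [y . p]. *)
Lemma char_sum p : \sum_(l < N) e (- pairing (v l) (invmx (Defs.realmx R M)^T *m latt R p)) =
  if `[< exists q, p = M^T *m q >] then N%:R else 0.
Proof.
have uB : (Defs.realmx R M)^T \in unitmx by rewrite unitmx_tr realmx_unit.
have BE q : (Defs.realmx R M)^T *m latt R q = latt R (M^T *m q).
  by rewrite lattM /Defs.realmx map_trmx.
case: asboolP => [[q ->]|np].
  rewrite -[RHS]mulr1n -[in RHS](card_ord N) -sumr_const; apply: eq_bigr => l _.
  by rewrite -BE mulKmx //; have [k ->] := pairing_latt (v l) q; rewrite eN e_int conjc1.
pose chi a := e (- pairing a (invmx (Defs.realmx R M)^T *m latt R p)).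
have chiD a b : chi (a + b) = chi a * chi b by rewrite /chi pairingDl opprD eD.
have chiM y : chi (M *m y) = 1.
  rewrite /chi /pairing lattM trmx_mul -mulmxA mulKVmx //.
  by have [k] := pairing_latt y p; rewrite /pairing => ->; rewrite eN e_int conjc1.
(* Were the character 1 on all basis vectors, the coordinates of the inverse transpose applied to
   [p] would be integers, and [p] would lie in the image of [M^T]. *)
have [i chii] : exists i, chi (delta_mx i 0) != 1.
  apply/not_existsP => h; apply: np.
  have /choice[q qE] : forall i, exists k : int,
      (invmx (Defs.realmx R M)^T *m latt R p) i 0 = k%:~R.
    move=> i; have /negP/negPn/eqP := h i; rewrite /chi pairing_delta eN.
    move/(congr1 conjc); rewrite conjcK conjc1; exact: e_eq1.
  exists (\col_i q i); apply: latt_inj; rewrite -BE -[LHS](mulKVmx uB).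
  by congr (_ *m _); apply/colP => i; rewrite qE !mxE.
exact: char_sum_repr vM chiD chiM chii.
Qed.

End CharacterSum.

(** * The inner product on square-summable functions *)

Section EsumHasSum.
Variables (R : realType) (I : choiceType) (g : I -> R).
Hypothesis g0 : forall i, 0 <= g i.

Lemma esum_le_has_sum (s : R) : has_sum (fun i => (g i)%:C) s%:C ->
  (\esum_(i in [set: I]) (g i)%:E <= s%:E)%E.
Proof.
move=> gs; apply: ge_ereal_sup => _ [B [finB _] <-].
by rewrite fsbig_finite //= sumEFin lee_fin; exact: has_sum_ub gs _.
Qed.

Lemma has_sum_esum_le (M : R) : (\esum_(i in [set: I]) (g i)%:E <= M%:E)%E ->
  exists2 s : R, has_sum (fun i => (g i)%:C) s%:C & s <= M.
Proof.
move=> gM; have [//|B|s [gs sM _]] := @has_sum_ge0 R I g M; last by exists s.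
rewrite -lee_fin -sumEFin (le_trans _ gM) //.
apply: ereal_sup_ubound; exists [set` B]; first by split.
by rewrite fsbig_finite //= set_fsetK.
Qed.

Lemma has_sum_ge0_dom (f : I -> R) (s : R) : (forall i, 0 <= f i <= g i) ->
  has_sum (fun i => (g i)%:C) s%:C ->
  exists2 r : R, has_sum (fun i => (f i)%:C) r%:C & r <= s.
Proof.
move=> fg gs.
have [i|B|r [fr rs _]] := @has_sum_ge0 R I f s; last by exists r.
  by case/andP: (fg i).
apply: le_trans (has_sum_ub g0 gs B); apply: ler_sum => i _.
by case/andP: (fg i).
Qed.

End EsumHasSum.

Lemma has_sum_finite (R : realType) (I : choiceType) (f : I -> R[i]) (A : {fset I}) :
  (forall i, i \notin A -> f i = 0) -> has_sum f (\sum_(i <- A) f i).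
Proof.
move=> fA; apply/has_sumP => eps e0; exists A => B AB.
rewrite (big_fset_incl _ AB) ?subrr ?normr0 ?ltcR // => i _; exact: fA.
Qed.

Section Inner.
Variables (R : realType) (n : nat).
Notation F := ('cV[R]_n -> R[i]).
Implicit Types (xi eta zeta : F) (t u : 'cV[R]_n) (p q : 'cV[int]_n).

(** Removes the supremum and the square root: a norm bound is the same bound at every [t], the form
    in which all later estimates are made. *)
Lemma modnorm_le xi (r : R) : 0 <= r ->
  (modnorm xi <= r%:E)%E <->
  forall t, (\esum_(p in [set: 'cV[int]_n])
     ((Normc.normc (xi (t - latt R p))) ^+ 2)%:E <= (r ^+ 2)%:E)%E.
Proof.
move=> r0; rewrite /modnorm.
set S := ereal_sup _.
have es0 t : (0 <= \esum_(p in [set: 'cV[int]_n])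
     ((Normc.normc (xi (t - latt R p))) ^+ 2)%:E)%E.
  by apply: esum_ge0 => p _; rewrite lee_fin sqr_ge0.
have S0 : (0 <= S)%E by apply: le_trans (es0 0) _; apply: ereal_sup_ubound; exists 0.
have -> : (S `^ (2^-1) <= r%:E)%E = (S <= (r ^+ 2)%:E)%E.
  apply/idP/idP => [Sr|Sr].
    have := @gt0_ler_poweR R 2 (ler0n _ 2) _ _ _ _ Sr.
    rewrite !in_itv /= !leey !andbT poweR_ge0 lee_fin r0 => /(_ isT isT).
    by rewrite -poweRrM mulVf // poweRe1 // powR_mulrn.
  have := @gt0_ler_poweR R 2^-1 _ _ _ _ _ Sr.
  rewrite !in_itv /= !leey !andbT lee_fin sqr_ge0 S0 invr_ge0 ler0n => /(_ isT isT isT).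
  by rewrite -powR_mulrn // -powRrM mulfV // powRr1.
split=> [Sr t|H]; first by apply: le_trans Sr; apply: ereal_sup_ubound; exists t.
by apply: ge_ereal_sup => _ [t _ <-].
Qed.

(** Pointwise in [t], with no uniformity; between two such functions [inner] is a genuine sum. *)
Definition l2 xi : Prop := forall t, exists s : R,
  has_sum (fun p => (Normc.normc (xi (t - latt R p)) ^+ 2)%:C) s%:C.

Definition lperiodic (f : F) : Prop := forall t p, f (t + latt R p) = f t.

Definition sqn xi t : R := complex.Re (inner xi xi t).

Lemma conj_mul (z : R[i]) : conjc z * z = (Normc.normc z ^+ 2)%:C.
Proof. by rewrite mulrC -sqr_normc norm_normc rmorphXn. Qed.

(** From [2 a b <= l a^2 + l^-1 b^2] termwise. The free weight [l] makes this a substitute for the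
    Cauchy-Schwarz inequality. *)
Lemma inner_has_sum_le xi eta t (l s r : R) : 0 < l ->
  has_sum (fun p => (Normc.normc (xi (t - latt R p)) ^+ 2)%:C) s%:C ->
  has_sum (fun p => (Normc.normc (eta (t - latt R p)) ^+ 2)%:C) r%:C ->
  has_sum (fun p => conjc (xi (t - latt R p)) * eta (t - latt R p)) (inner xi eta t)
  /\ `|inner xi eta t| <= ((l * s + l^-1 * r) / 2)%:C.
Proof.
move=> l0 xs er.
have := has_sumZ (c := 2^-1) (has_sumD (has_sumZ (c := l%:C) xs) (has_sumZ (c := l^-1%:C) er)).
have -> : 2^-1 * (l%:C * s%:C + l^-1%:C * r%:C) = ((l * s + l^-1 * r) / 2)%:C.
  by rewrite mulrC !(rmorphM, rmorphD, fmorphV).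
move=> xer.
have [||z fz zle] := @has_sum_dom _ _ (fun p => conjc (xi (t - latt R p)) * eta (t - latt R p))
  (fun p => (l * Normc.normc (xi (t - latt R p)) ^+ 2 +
     l^-1 * Normc.normc (eta (t - latt R p)) ^+ 2) / 2) ((l * s + l^-1 * r) / 2).
- move=> p; rewrite normrM normcJ !norm_normc -rmorphM lecR /=.
  move: (Normc.normc _) (Normc.normc _) => b a.
  rewrite ler_pdivlMr // -subr_ge0.
  rewrite [leRHS](_ : _ = l^-1 * (l * a - b) ^+ 2); last first.
    by field; rewrite gt_eqF.
  by rewrite mulr_ge0 ?sqr_ge0 // invr_ge0 ltW.
- apply: eq_has_sum xer => p.
  by rewrite mulrC !(rmorphM, rmorphD, fmorphV).
by rewrite /inner (has_sumE fz).
Qed.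

Lemma inner_has_sum xi eta t : l2 xi -> l2 eta ->
  has_sum (fun p => conjc (xi (t - latt R p)) * eta (t - latt R p)) (inner xi eta t).
Proof.
move=> /(_ t)[s xs] /(_ t)[r er].
by have [] := inner_has_sum_le ltr01 xs er.
Qed.

Lemma sqnP xi t : l2 xi ->
  has_sum (fun p => (Normc.normc (xi (t - latt R p)) ^+ 2)%:C) (sqn xi t)%:C.
Proof.
move=> xl2; have [s xs] := xl2 t.
suff -> : sqn xi t = s by [].
rewrite /sqn /inner (has_sumE (s := s%:C)) //.
by apply: eq_has_sum xs => p; rewrite conj_mul.
Qed.

Lemma innerxx xi t : l2 xi -> inner xi xi t = (sqn xi t)%:C.
Proof.
move=> xl2; rewrite /inner (has_sumE (s := (sqn xi t)%:C)) //.
by apply: eq_has_sum (sqnP (t := t) xl2) => p; rewrite conj_mul.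
Qed.

Lemma sqn_ge0 xi t : l2 xi -> 0 <= sqn xi t.
Proof.
move=> xl2; have := has_sum_ub _ (sqnP (t := t) xl2) fset0.
by rewrite big_seq_fset0; apply=> p; rewrite sqr_ge0.
Qed.

Lemma inner_le xi eta t (l : R) : 0 < l -> l2 xi -> l2 eta ->
  `|inner xi eta t| <= ((l * sqn xi t + l^-1 * sqn eta t) / 2)%:C.
Proof.
by move=> l0 xl2 el2; have [] := inner_has_sum_le l0 (sqnP (t := t) xl2) (sqnP (t := t) el2).
Qed.

Lemma innerE xi eta t z :
  has_sum (fun p => conjc (xi (t - latt R p)) * eta (t - latt R p)) z ->
  inner xi eta t = z.
Proof. exact: has_sumE. Qed.

Lemma sqnE xi t (s : R) :
  has_sum (fun p => (Normc.normc (xi (t - latt R p)) ^+ 2)%:C) s%:C -> sqn xi t = s.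
Proof.
move=> xs; rewrite /sqn (innerE (z := s%:C)) //.
by apply: eq_has_sum xs => p; rewrite conj_mul.
Qed.

Lemma l2_sqn_dom xi t (g : 'cV[int]_n -> R) (s : R) :
  (forall p, Normc.normc (xi (t - latt R p)) ^+ 2 <= g p) ->
  has_sum (fun p => (g p)%:C) s%:C ->
  exists2 r : R, has_sum (fun p => (Normc.normc (xi (t - latt R p)) ^+ 2)%:C) r%:C
    & r <= s.
Proof.
move=> xg gs; apply: (has_sum_ge0_dom _ _ gs) => p; last by rewrite sqr_ge0 xg.
exact: le_trans (sqr_ge0 _) (xg p).
Qed.

Lemma l2D_sqn_le xi eta t : l2 xi -> l2 eta ->
  exists2 r : R, has_sum (fun p => (Normc.normc ((xi + eta) (t - latt R p)) ^+ 2)%:C) r%:C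
    & r <= 2 * (sqn xi t + sqn eta t).
Proof.
move=> xl2 el2; apply: (l2_sqn_dom (g := fun p => 2 *
    (Normc.normc (xi (t - latt R p)) ^+ 2 + Normc.normc (eta (t - latt R p)) ^+ 2))).
  move=> p; set a := xi _; set b := eta _.
  have ab : Normc.normc (a + b) <= Normc.normc a + Normc.normc b by exact: le_normcD.
  have ab0 : 0 <= Normc.normc (a + b) by case: (a + b) => ? ?; exact: sqrtr_ge0.
  rewrite [leLHS](_ : _ = Normc.normc (a + b) ^+ 2) //.
  move: (Normc.normc a) (Normc.normc b) ab => x y ab.
  rewrite (@le_trans _ _ ((x + y) ^+ 2)) //.
    by rewrite ler_sqr ?nnegrE // (le_trans ab0).
  rewrite -subr_ge0 [leRHS](_ : _ = (x - y) ^+ 2) ?sqr_ge0 //; ring.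
have := has_sumZ (c := 2%:C) (has_sumD (sqnP (t := t) xl2) (sqnP (t := t) el2)).
rewrite -rmorphD -rmorphM; apply: eq_has_sum => p.
by rewrite -rmorphD -rmorphM.
Qed.

Lemma l2D xi eta : l2 xi -> l2 eta -> l2 (xi + eta).
Proof.
by move=> xl2 el2 t; have [r xer _] := l2D_sqn_le t xl2 el2; exists r.
Qed.

Lemma sqnD_le xi eta t : l2 xi -> l2 eta ->
  sqn (xi + eta) t <= 2 * (sqn xi t + sqn eta t).
Proof.
by move=> xl2 el2; have [r xer rle] := l2D_sqn_le t xl2 el2; rewrite (sqnE xer).
Qed.

(** On the translates of [t] the factor [f] is the constant [f t]. *)
Lemma l2M xi f : lperiodic f -> l2 xi -> l2 (xi * f).
Proof.
move=> fper xl2 t; exists (Normc.normc (f t) ^+ 2 * sqn xi t).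
have := has_sumZ (c := (Normc.normc (f t) ^+ 2)%:C) (sqnP (t := t) xl2).
rewrite -rmorphM; apply: eq_has_sum => p.
rewrite -rmorphM; congr (_%:C).
have -> : (xi * f) (t - latt R p) = f t * xi (t - latt R p).
  by rewrite mulrC; congr (_ * _); rewrite -[in RHS](subrK (latt R p) t) fper.
by rewrite Normc.normcM exprMn.
Qed.

Lemma l2N xi : l2 xi -> l2 (- xi).
Proof.
move=> xl2; rewrite -[xi]mulr1 -mulrN; apply: l2M => // t p.
Qed.

Lemma l2B xi eta : l2 xi -> l2 eta -> l2 (xi - eta).
Proof. by move=> xl2 el2; apply/l2D/l2N. Qed.

Lemma l2_0 : l2 (0 : F).
Proof.
move=> t; exists 0; apply: eq_has_sum (@has_sum0 _ _) => p.
by rewrite (_ : (0 : F) _ = 0) // Normc.normc0 expr0n.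
Qed.

Lemma l2_sum (L : Type) (r : seq L) (f : L -> F) : (forall k, l2 (f k)) ->
  l2 (\sum_(k <- r) f k).
Proof.
move=> fl2; elim/big_ind: _ => [|x y|k _]; [exact: l2_0|exact: l2D|exact: fl2].
Qed.

Lemma modnorm_l2 xi (r : R) : 0 <= r -> (modnorm xi <= r%:E)%E ->
  l2 xi /\ forall t, sqn xi t <= r ^+ 2.
Proof.
move=> r0 /(modnorm_le xi r0) xr.
have ex t : exists2 s : R,
    has_sum (fun p => (Normc.normc (xi (t - latt R p)) ^+ 2)%:C) s%:C & s <= r ^+ 2.
  by apply: has_sum_esum_le (xr t) => p; rewrite sqr_ge0.
by split=> t; have [s xs sr] := ex t; [exists s|rewrite (sqnE xs)].
Qed.

Lemma l2_modnorm xi (r : R) : 0 <= r -> l2 xi -> (forall t, sqn xi t <= r ^+ 2) ->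
  (modnorm xi <= r%:E)%E.
Proof.
move=> r0 xl2 xr; apply/(modnorm_le xi r0) => t.
apply: (le_trans (esum_le_has_sum _ (sqnP (t := t) xl2))).
  by move=> p; rewrite sqr_ge0.
by rewrite lee_fin.
Qed.

(** The term at [p = 0] alone is [|xi t|^2]. *)
Lemma sqn_eq0 xi : l2 xi -> (forall t, sqn xi t <= 0) -> xi = 0.
Proof.
move=> xl2 x0; apply/funext => t.
have := has_sum_ub _ (sqnP (t := t) xl2) [fset (0 : 'cV[int]_n)]%fset.
rewrite big_seq_fset1 /latt map_mx0 subr0 => /(_ (fun p => sqr_ge0 _)) /le_trans /(_ (x0 t)).
rewrite le_eqVlt ltNge sqr_ge0 orbF sqrf_eq0 => /eqP; exact: Normc.eq0_normc.
Qed.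

Lemma inner_conj xi eta t : l2 xi -> l2 eta ->
  inner eta xi t = conjc (inner xi eta t).
Proof.
move=> xl2 el2; apply: innerE; apply: eq_has_sum (has_sum_conj (inner_has_sum (t := t) xl2 el2)).
by move=> p; rewrite rmorphM /= conjcK mulrC.
Qed.

Lemma innerDr xi eta zeta : l2 xi -> l2 eta -> l2 zeta ->
  inner xi (eta + zeta) = inner xi eta + inner xi zeta.
Proof.
move=> xl2 el2 zl2; apply/funext => t; apply: innerE.
apply: eq_has_sum (has_sumD (inner_has_sum (t := t) xl2 el2) (inner_has_sum (t := t) xl2 zl2)) => p.
by rewrite -mulrDr.
Qed.

Lemma innerMr xi eta f : lperiodic f -> l2 xi -> l2 eta ->
  inner xi (eta * f) = inner xi eta * f.
Proof.
move=> fper xl2 el2; apply/funext => t; apply: innerE.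
rewrite [(_ * _) t]mulrC.
apply: eq_has_sum (has_sumZ (c := f t) (inner_has_sum (t := t) xl2 el2)) => p.
rewrite mulrCA; congr (_ * _); rewrite mulrC; congr (_ * _).
by rewrite -[in LHS](subrK (latt R p) t) fper.
Qed.

Lemma innerr0 xi : inner xi 0 = 0.
Proof.
apply/funext => t; apply: innerE; apply: eq_has_sum (@has_sum0 _ _) => p.
by rewrite mulr0.
Qed.

Lemma innerBr xi eta zeta : l2 xi -> l2 eta -> l2 zeta ->
  inner xi (eta - zeta) = inner xi eta - inner xi zeta.
Proof.
move=> xl2 el2 zl2; rewrite innerDr //; last exact: l2N.
by congr (_ + _); rewrite -mulrN1 innerMr // mulrN1.
Qed.

Lemma inner_sumr xi (L : Type) (r : seq L) (f : L -> F) :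
  l2 xi -> (forall k, l2 (f k)) ->
  inner xi (\sum_(k <- r) f k) = \sum_(k <- r) inner xi (f k).
Proof.
move=> xl2 fl2; elim: r => [|k r IH]; first by rewrite !big_nil innerr0.
by rewrite !big_cons innerDr ?IH //; exact: l2_sum.
Qed.

Lemma inner_periodic xi eta : l2 xi -> l2 eta -> lperiodic (inner xi eta).
Proof.
move=> xl2 el2 t q; apply: innerE.
apply: (has_sum_inj (h := fun p => p + q)).
- exact: addIr.
- by move=> p []; exists (p - q) => //; rewrite subrK.
apply: eq_has_sum (inner_has_sum (t := t) xl2 el2) => p.
by rewrite lattD opprD addrACA subrr addr0.
Qed.

Lemma inner0_sym xi eta : l2 xi -> l2 eta -> inner xi eta = 0 -> inner eta xi = 0.
Proof.
move=> xl2 el2 xe; apply/funext => t.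
by rewrite (inner_conj t xl2 el2) xe conjc0.
Qed.

End Inner.

(** * Continuity of the inner product *)

Section InnerLeft.
Variables (R : realType) (n : nat).
Notation F := ('cV[R]_n -> R[i]).
Implicit Types (xi eta zeta f : F) (t u : 'cV[R]_n) (p q : 'cV[int]_n).

Lemma innerDl xi eta zeta : l2 xi -> l2 eta -> l2 zeta ->
  inner (xi + eta) zeta = inner xi zeta + inner eta zeta.
Proof.
move=> xl2 el2 zl2; apply/funext => t.
rewrite (inner_conj t zl2 (l2D xl2 el2)) innerDr //.
transitivity (conjc (inner zeta xi t + inner zeta eta t)) => //.
by rewrite rmorphD /= -!inner_conj.
Qed.

Lemma innerMl xi eta f t : lperiodic f -> l2 xi -> l2 eta ->
  inner (xi * f) eta t = inner xi eta t * conjc (f t).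
Proof.
move=> fper xl2 el2.
rewrite (inner_conj t el2 (l2M fper xl2)) innerMr // (inner_conj t el2 xl2).
by rewrite -rmorphM.
Qed.

Lemma innerNl xi eta t : l2 xi -> l2 eta -> inner (- xi) eta t = - inner xi eta t.
Proof.
move=> xl2 el2; rewrite -[- xi]mulrN1 innerMl //.
by rewrite (_ : (-1 : F) t = -1) // rmorphN rmorph1 mulrN1.
Qed.

Lemma sqnN xi t : l2 xi -> sqn (- xi) t = sqn xi t.
Proof.
move=> xl2; apply: sqnE; apply: eq_has_sum (sqnP (t := t) xl2) => p.
by rewrite (_ : (- xi) _ = - xi (t - latt R p)) // normcN.
Qed.

Lemma sqn_distC xi eta t : l2 xi -> l2 eta -> sqn (xi - eta) t = sqn (eta - xi) t.
Proof. by move=> xl2 el2; rewrite -[xi - eta]opprB sqnN //; exact: l2B. Qed.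

End InnerLeft.

Section Continuity.
Variables (R : realType) (n : nat).
Notation F := ('cV[R]_n -> R[i]).
Implicit Types (xi eta zeta g h : F) (t u : 'cV[R]_n) (p q : 'cV[int]_n).

Lemma coord_norm_le t i : `|t i 0| <= `|t|.
Proof.
rewrite [leRHS]/Num.norm /= mx_normrE.
exact: (le_bigmax (I := _) _ (fun ij => `|t ij.1 ij.2|) (i, 0)).
Qed.

Lemma latt_bounded_fset (D : R) : exists A : {fset 'cV[int]_n},
  forall p, `|latt R p| <= D -> p \in A.
Proof.
have [K DK] : exists K : nat, D <= K%:R.
  exists (Num.bound `|D|); rewrite (le_trans (ler_norm D)) //.
  exact/ltW/archi_boundP.
pose h (f : {ffun 'I_n -> 'I_(K * 2).+1}) : 'cV[int]_n :=
  \col_i ((f i : nat)%:Z - K%:Z).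
exists [fset h f | f in [set: {ffun 'I_n -> 'I_(K * 2).+1}]%SET]%fset => p pD.
have pK i : `|p i 0| <= K%:Z.
  rewrite -(ler_int R) intr_norm (le_trans _ DK) // (le_trans _ pD) //.
  by rewrite (le_trans _ (coord_norm_le _ i)) // mxE.
apply/imfsetP; exists [ffun i => inord (absz (p i 0 + K%:Z))]; first by rewrite /= inE.
apply/colP => i; have := pK i; rewrite mxE ffunE ler_norml => /andP[h1 h2].
have {h1 h2} h12 : (- K%:Z <= p i 0 :> int) && (p i 0 <= K%:Z :> int) by apply/andP.
by rewrite inordK; move: (p i 0) h12 => z; clear; lia.
Qed.

(** If [t - p] lies in the bounded support and [t] in the unit ball around [t0], then [p] is
    bounded. One finite set thus serves the whole ball, where inner products with [g] become finite
    sums. *)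
Lemma Cc_locally_finite g t0 : Cc g -> exists A : {fset 'cV[int]_n},
  forall t, `|t - t0| < 1 -> forall p, p \notin A -> g (t - latt R p) = 0.
Proof.
move=> [_ /compact_bounded[C [_ gC]]].
have [A HA] := latt_bounded_fset (`|t0| + 1 + (C + 1)).
exists A => t tt0 p; apply: contraNeq => gp; apply: HA.
have gle : `|t - latt R p| <= C + 1.
  by apply: gC; [rewrite ltrDl | exact: subset_closure].
rewrite -[latt R p](subKr t) (le_trans (ler_normB _ _)) // lerD //.
by rewrite -(subrK t0 t) (le_trans (ler_normD _ _)) // addrC lerD // ltW.
Qed.

Lemma l2_Cc g : Cc g -> l2 g.
Proof.
move=> gCc t; have [A HA] := Cc_locally_finite t gCc.
exists (\sum_(p <- A) Normc.normc (g (t - latt R p)) ^+ 2).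
rewrite raddf_sum /=; apply: has_sum_finite => p pA.
by rewrite (HA t) ?subrr ?normr0 // Normc.normc0 expr0n.
Qed.

Lemma Xi_approx xi (eps : R) : Xi xi -> 0 < eps ->
  exists g, [/\ Cc g, l2 g, l2 (xi - g) & forall t, sqn (xi - g) t <= eps ^+ 2].
Proof.
move=> xX e0; have [g gCc /ltW xg] := xX eps e0.
by have [] := modnorm_l2 (ltW e0) xg; exists g; split => //; exact: l2_Cc.
Qed.

Lemma l2_Xi xi : Xi xi -> l2 xi.
Proof.
move=> xX; have [g [_ gl2 xgl2 _]] := Xi_approx xX ltr01.
by rewrite -(subrK g xi); exact: l2D.
Qed.

Lemma continuous_shift g p : continuous (g : 'cV[R]_n -> (R[i])^o) ->
  continuous (fun t => g (t - latt R p) : (R[i])^o).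
Proof.
move=> gc t; have FF : Filter (nbhs t) by exact: nbhs_filter.
have c : (u - latt R p) @[u --> t] --> t - latt R p.
  apply/cvgrPdist_lt => eps eps0; near=> u.
  rewrite opprB addrA subrK; near: u; exact: cvgr_dist_lt.
exact: (cvg_comp _ _ c (gc _)).
Unshelve. all: by end_near. Qed.

Lemma continuous_mulc (f1 f2 : F) : continuous (f1 : 'cV[R]_n -> (R[i])^o) ->
  continuous (f2 : 'cV[R]_n -> (R[i])^o) ->
  continuous (fun t => f1 t * f2 t : (R[i])^o).
Proof.
move=> c1 c2 t; have FF : Filter (nbhs t) by exact: nbhs_filter.
exact: cvgM (c1 t) (c2 t).
Qed.

Lemma continuous_sumc (L : Type) (r : seq L) (f : L -> F) :
  (forall k, continuous (f k : 'cV[R]_n -> (R[i])^o)) ->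
  continuous (fun t => \sum_(k <- r) f k t : (R[i])^o).
Proof.
move=> fc; elim: r => [|k r IH] t; have FF : Filter (nbhs t) by exact: nbhs_filter.
  rewrite (_ : (fun t => _) = cst (0 : (R[i])^o)); first exact: cvg_cst.
  by apply/funext => u; rewrite big_nil.
rewrite (_ : (fun t => _) =
  (f k : 'cV[R]_n -> (R[i])^o) + (fun t => \sum_(k <- r) f k t : (R[i])^o)).
  exact: cvgD (fc k t) (IH t).
by apply/funext => u; rewrite big_cons.
Qed.

Lemma continuous_conjc (f : F) : continuous (f : 'cV[R]_n -> (R[i])^o) ->
  continuous (fun t => conjc (f t) : (R[i])^o).
Proof.
move=> fc t; have FF : Filter (nbhs t) by exact: nbhs_filter.
have /cvgrPdist_lt fct := fc t.
apply/cvgrPdist_lt => eps e0; have := fct _ e0; apply: filterS => u.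
by rewrite -rmorphB normcJ.
Qed.

Lemma inner_Cc_continuous g h : Cc g -> Cc h ->
  continuous (inner g h : 'cV[R]_n -> (R[i])^o).
Proof.
move=> gCc hCc t0; have FF : Filter (nbhs t0) by exact: nbhs_filter.
have [A HA] := Cc_locally_finite t0 hCc.
pose f t : (R[i])^o := \sum_(p <- A) (conjc (g (t - latt R p)) * h (t - latt R p)).
have fE t : `|t - t0| < 1 -> inner g h t = f t.
  move=> tt0; apply: innerE; apply: has_sum_finite => p pA.
  by rewrite (HA t) // mulr0.
have fc : continuous f.
  apply: continuous_sumc => p; apply: continuous_mulc.
    by apply/continuous_conjc/continuous_shift; case: gCc.
  by apply: continuous_shift; case: hCc.
rewrite /continuous_at (fE t0) ?subrr ?normr0 //.
apply: cvg_trans (fc t0); apply: near_eq_cvg.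
apply: filterS (nbhsx_ballx t0 1 ltr01) => t.
by rewrite -ball_normE /= distrC => /fE ->.
Qed.

Lemma Xi_sqn_locally_bounded xi t0 : Xi xi ->
  exists C : R, \forall t \near t0, sqn xi t <= C.
Proof.
move=> xX; have [g [gCc gl2 xgl2 xg]] := Xi_approx xX ltr01.
(* Split [xi = (xi - g) + g]: the first part contributes at most 1, the second stays within 1 of its
   value at [t0] by continuity. *)
exists (2 * (1 + (sqn g t0 + 1))).
have FF : Filter (nbhs t0) by exact: nbhs_filter.
have /cvgrPdist_lt gc := @inner_Cc_continuous g g gCc gCc t0.
have := gc _ ltr01; apply: filterS => t.
rewrite !innerxx // -rmorphB norm_normc ltcR /= expr0n addr0 sqrtr_sqr => gt.
rewrite -[xi](subrK g) (le_trans (sqnD_le t xgl2 gl2)) // ler_pM2l // lerD //.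
  by rewrite (le_trans (xg t)) // expr1n.
by move: gt; rewrite ltr_norml => /andP[]; lra.
Qed.

(** The difference is [<xi - g, eta> + <g, eta - h>]. Weighting each small factor by [l^-1] and the
    other by [l] makes both terms of order [l]. *)
Lemma inner_approx xi eta g h t (l C : R) : 0 < l <= 1 ->
  l2 xi -> l2 eta -> l2 g -> l2 h ->
  sqn (xi - g) t <= l ^+ 2 -> sqn (eta - h) t <= l ^+ 2 ->
  sqn xi t <= C -> sqn eta t <= C ->
  `|inner xi eta t - inner g h t| <= (2 * l * (C + 1))%:C.
Proof.
move=> /andP[l0 l1] xl2 el2 gl2 hl2 xg eh xC eC.
have xgl2 := l2B xl2 gl2; have ehl2 := l2B el2 hl2.
have li : l^-1 * l ^+ 2 = l by rewrite expr2 mulKf // gt_eqF.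
have C0 : 0 <= C by exact: le_trans (sqn_ge0 t xl2) xC.
have gC : sqn g t <= 2 * (l ^+ 2 + C).
  rewrite -[g](subrK xi) (le_trans (sqnD_le t (l2B gl2 xl2) xl2)) //.
  by rewrite ler_pM2l // lerD // sqn_distC.
have ll : l ^+ 2 <= 1 by rewrite expr_le1 // ltW.
have -> : inner xi eta t - inner g h t = inner (xi - g) eta t + inner g (eta - h) t.
  rewrite innerBr //; rewrite innerDl //; last exact: l2N.
  rewrite [RHS](_ : _ = inner xi eta t + inner (- g) eta t +
    (inner g eta t - inner g h t)) // innerNl //.
  by rewrite addrA subrK.
apply: le_trans (ler_normD _ _) _.
apply: le_trans (lerD (inner_le (l := l^-1) t _ xgl2 el2) (inner_le (l := l) t _ gl2 ehl2)) _.
- by rewrite invr_gt0.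
- by [].
rewrite -rmorphD lecR invrK.
have h1 : l^-1 * sqn (xi - g) t <= l by rewrite -[leRHS]li ler_pM2l // invr_gt0.
have h2 : l^-1 * sqn (eta - h) t <= l by rewrite -[leRHS]li ler_pM2l // invr_gt0.
have h3 : l * sqn eta t <= l * C by rewrite ler_pM2l.
have h4 : l * sqn g t <= l * (2 * (1 + C)) by rewrite ler_pM2l //; lra.
have h5 : 0 <= l * C by rewrite mulr_ge0 // ltW.
by lra.
Qed.

(** Near [t0] the inner product is a uniform limit of continuous inner products of [Cc] functions.
    Frame coefficients therefore belong to [CT]. *)
Lemma inner_Xi_continuous xi eta : Xi xi -> Xi eta ->
  continuous (inner xi eta : 'cV[R]_n -> (R[i])^o).
Proof.
move=> xX eX t0; have FF : Filter (nbhs t0) by exact: nbhs_filter.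
have [C1 xC] := Xi_sqn_locally_bounded t0 xX.
have [C2 eC] := Xi_sqn_locally_bounded t0 eX.
pose C := Num.max C1 C2.
have xl2 := l2_Xi xX; have el2 := l2_Xi eX.
have C0 : 0 <= C.
  by rewrite le_max (le_trans (sqn_ge0 t0 xl2)) //; exact: nbhs_singleton xC.
apply/cvgrPdist_lt => eps; case: eps => a b; rewrite ltcE /=.
move=> /andP[/eqP -> a0].
(* Chosen so that the error [2 * l * (C + 1)] of [inner_approx] is at most [a / 3]. *)
pose l := Num.min 1 (a / (6 * (C + 1))).
have l0 : 0 < l by rewrite lt_min ltr01 divr_gt0 // mulr_gt0 //; lra.
have l1 : l <= 1 by rewrite ge_min lexx.
have la : 2 * l * (C + 1) <= a / 3.
  have : l <= a / (6 * (C + 1)) by rewrite ge_min lexx orbT.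
  rewrite ler_pdivlMr; last by rewrite mulr_gt0 //; lra.
  by lra.
have [g [gCc gl2 _ xg]] := Xi_approx xX l0.
have [h [hCc hl2 _ eh]] := Xi_approx eX l0.
have /cvgrPdist_lt ghc := @inner_Cc_continuous g h gCc hCc t0.
have a3 : 0 < (a / 3)%:C by rewrite ltcR divr_gt0.
have gh := ghc _ a3.
have est t : sqn xi t <= C1 -> sqn eta t <= C2 ->
    `|inner xi eta t - inner g h t| <= (a / 3)%:C.
  move=> xt et.
  apply: le_trans (inner_approx (l := l) (C := C) _ xl2 el2 gl2 hl2 (xg t) (eh t) _ _) _.
  - by rewrite l0.
  - by rewrite le_max xt.
  - by rewrite le_max et orbT.
  - by rewrite lecR.
have x0 := est t0 (nbhs_singleton xC) (nbhs_singleton eC).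
apply: filterS3 xC eC gh => t xt et ght.
have xt0 := est t xt et.
rewrite -[_ - _](_ : (inner xi eta t0 - inner g h t0) + (inner g h t0 - inner g h t) +
  (inner g h t - inner xi eta t) = _); last by rewrite !addrA !subrK.
apply: le_lt_trans (ler_normD _ _) _.
rewrite [X in _ + X]distrC; apply: le_lt_trans (lerD (ler_normD _ _) xt0) _.
have -> : a +i* 0 = (a / 3)%:C + (a / 3)%:C + (a / 3)%:C.
  by rewrite -!rmorphD /=; congr (_ +i* _); lra.
by rewrite ltrD2r; apply: ler_ltD.
Qed.

End Continuity.

(** * Dilations *)

Lemma conjc_scale (R : realType) (c : R) (z : R[i]) : conjc (c%:C * z) = c%:C * conjc z.
Proof. by rewrite -[in RHS](conjc_real c) -rmorphM. Qed.

(** * Characters and other continuous periodic functions *)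

Section CTFunctions.
Variables (R : realType) (n : nat).
Notation F := ('cV[R]_n -> R[i]).
Implicit Types (xi eta zeta f : F) (t u : 'cV[R]_n) (p q v : 'cV[int]_n).

Lemma norm_mulmx_le m (B : 'M[R]_(m, n)) : exists2 K : R, 0 < K &
  forall u, `|B *m u| <= K * `|u|.
Proof.
(* The summand 1 keeps the constant positive even for [B = 0], so that one may divide by it. *)
exists (\sum_i \sum_j `|B i j| + 1).
  by rewrite ltr_wpDl // sumr_ge0 // => i _; apply: sumr_ge0.
move=> u; rewrite [leLHS]/Num.norm /= mx_normrE.
have K0 : 0 <= \sum_i \sum_j `|B i j| by rewrite sumr_ge0 // => i _; apply: sumr_ge0.
apply: bigmax_le => [|[i k] _ /=]; first by rewrite mulr_ge0 // addr_ge0.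
rewrite mxE (le_trans (ler_norm_sum _ _ _)) //.
apply: (@le_trans _ _ ((\sum_j `|B i j|) * `|u|)).
  rewrite mulr_suml; apply: ler_sum => j _; rewrite normrM ler_wpM2l //.
  by rewrite ord1 coord_norm_le.
rewrite ler_wpM2r // ler_wpDr // (bigD1 i) //= lerDl sumr_ge0 // => j _.
exact: sumr_ge0.
Qed.

Lemma continuous_mulmx m (B : 'M[R]_(m, n)) : continuous (mulmx B : 'cV[R]_n -> 'cV[R]_m).
Proof.
move=> t; have FF : Filter (nbhs t) by exact: nbhs_filter.
have [K K0 BK] := norm_mulmx_le B.
apply/cvgrPdist_lt => eps e0; apply: filterS (nbhsx_ballx t (eps / K) _) => [u|].
  rewrite -ball_normE /= => tu; rewrite -mulmxBr (le_lt_trans (BK _)) //.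
  by rewrite mulrC -ltr_pdivlMr.
by rewrite divr_gt0.
Qed.

Lemma continuous_complex (f1 f2 : 'cV[R]_n -> R) : continuous f1 -> continuous f2 ->
  continuous (fun t => f1 t +i* f2 t : (R[i])^o).
Proof.
move=> c1 c2 t; have FF : Filter (nbhs t) by exact: nbhs_filter.
have /cvgrPdist_lt h1 := c1 t; have /cvgrPdist_lt h2 := c2 t.
apply/cvgrPdist_lt => eps; case: eps => a b; rewrite ltcE /= => /andP[/eqP -> a0].
have a2 : 0 < a / 2 by rewrite divr_gt0.
apply: filterS2 (h1 _ a2) (h2 _ a2) => u u1 u2.
rewrite [X in `|X|](_ : _ = (f1 t - f1 u)%:C + 'i%C * (f2 t - f2 u)%:C); last first.
  by apply/eqP; rewrite eq_complex /= !mul0r !mul1r subr0 !addr0 !add0r !eqxx.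
apply: le_lt_trans (ler_normD _ _) _.
rewrite normrM (_ : `|'i%C| = 1) ?mul1r; last first.
  by rewrite normc_def /= expr0n add0r expr1n sqrtr1.
rewrite !norm_normc /= !expr0n !addr0 !sqrtr_sqr -rmorphD ltcR /=.
by rewrite [ltRHS](splitr a) ltrD.
Qed.

Definition chi v : F := fun t => e (- pairing v t).

Lemma eps_opE v xi : eps_op v xi = xi * chi v.
Proof. by apply/funext => t; rewrite [RHS]mulrC. Qed.

Lemma CT_periodic f : CT f -> lperiodic f.
Proof. by case. Qed.

Lemma CT_chi v : CT (chi v).
Proof.
split; last first.
  move=> t p; rewrite /chi pairingDr opprD eD; have [k ->] := pairing_latt R v p.
  by rewrite -mulrNz e_int mulr1.
have pc : continuous (fun t => 2 * pi * (- pairing v t)).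
  move=> t; have FF : Filter (nbhs t) by exact: nbhs_filter.
  apply: cvgMl_tmp; apply: cvgN.
  exact: (cvg_comp _ _ (@continuous_mulmx 1 (latt R v)^T t) (@coord_continuous _ _ _ 0 0 _)).
apply: continuous_complex => t.
  exact: (cvg_comp _ _ (pc t) (@continuous_cos _ _)).
exact: (cvg_comp _ _ (pc t) (@continuous_sin _ _)).
Qed.

(** Periodicity survives because [M^T] maps the lattice into itself. This is the form a multiplier
    takes when it is moved inside a dilation. *)
Lemma CT_mulmx (M : 'M[int]_n) f : CT f -> CT (fun t => f ((Defs.realmx R M)^T *m t)).
Proof.
case=> fc fp; split=> [t|t p].
  exact: (cvg_comp _ _ (@continuous_mulmx _ (Defs.realmx R M)^T t) (fc _)).
rewrite mulmxDr (_ : _ *m latt R p = latt R (M^T *m p)) //.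
by rewrite lattM /Defs.realmx map_trmx.
Qed.

Lemma CT_inner xi eta : Xi xi -> Xi eta -> CT (inner xi eta).
Proof.
move=> xX eX; split; first exact: inner_Xi_continuous.
by apply: inner_periodic; exact: l2_Xi.
Qed.

End CTFunctions.

(** * Dilations and the inner product *)

Section Dilation.
Variables (R : realType) (n : nat).
Notation F := ('cV[R]_n -> R[i]).
Implicit Types (xi eta zeta f : F) (t u : 'cV[R]_n) (p q : 'cV[int]_n).
Variables (M : 'M[int]_n) (s : R).
Hypothesis dM : \det M != 0.

Local Notation B := (Defs.realmx R M)^T.

(** Matrix and scalar are separate parameters, so that every power of the dilation is an instance
    with [M = A ^+ i]. *)
Definition dilM xi : F := fun t => s%:C * xi (invmx B *m t).

Lemma unitB : B \in unitmx.
Proof. by rewrite unitmx_tr realmx_unit. Qed.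

Lemma invB_latt q : invmx B *m latt R (M^T *m q) = latt R q.
Proof. by rewrite lattM /Defs.realmx -map_trmx mulKmx // unitB. Qed.

Section Cosets.
Variables (N : nat) (w : nat -> 'cV[int]_n).
Hypothesis wM : repr_sys M^T N w.

Lemma has_sum_cosets (f : 'cV[int]_n -> R[i]) (S : 'I_N -> R[i]) :
  (forall c : 'I_N, has_sum (fun q => f (w c + M^T *m q)) (S c)) ->
  has_sum f (\sum_c S c).
Proof.
(* [g c] is [f] cut off outside the coset of [w c]; each [p] lies in exactly one coset, so these
   pieces add up to [f]. *)
move=> fS; pose g (c : 'I_N) p := if `[< exists q, p = w c + M^T *m q >] then f p else 0.
have gS (c : 'I_N) : has_sum (g c) (S c).
  apply: (has_sum_inj (h := fun q => w c + M^T *m q)).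
  - by move=> x y /addrI /mulmx_int_inj; apply; rewrite det_tr.
  - by move=> p np; rewrite /g; case: asboolP => // -[q pE]; case: np; exists q.
  apply: eq_has_sum (fS c) => q; rewrite /g; case: asboolP => // np.
  by case: np; exists q.
have := has_sum_bigD (r := index_enum 'I_N) (f := g) gS; apply: eq_has_sum => p.
have [c cN [q pE]] := wM.1 p.
rewrite (bigD1 (Ordinal cN)) //= [X in X + _](_ : _ = f p); last first.
  by rewrite /g; case: asboolP => // np; case: np; exists q.
rewrite big1 ?addr0 // => c' c'c; rewrite /g; case: asboolP => // -[q' pE'].
case/eqP: c'c; apply/val_inj/(wM.2 _ _ (q - q')) => //=.
by rewrite mulmxBr addrA -pE pE' addrK.
Qed.

(** Along a coset [w c + M^T q] the inverse of [B] turns the step [M^T q] into [q], so each coset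
    contributes one full inner product. Dilations hence preserve square-summability and
    orthogonality. *)
Lemma has_sum_dilM xi eta t : l2 xi -> l2 eta ->
  has_sum (fun p => conjc (dilM xi (t - latt R p)) * dilM eta (t - latt R p))
    ((s ^+ 2)%:C * \sum_(c < N) inner xi eta (invmx B *m (t - latt R (w c)))).
Proof.
move=> xl2 el2.
have h : has_sum (fun p => conjc (xi (invmx B *m (t - latt R p))) *
    eta (invmx B *m (t - latt R p)))
    (\sum_(c < N) inner xi eta (invmx B *m (t - latt R (w c)))).
  apply: has_sum_cosets => c.
  apply: eq_has_sum (inner_has_sum (t := invmx B *m (t - latt R (w c))) xl2 el2) => q.
  by rewrite lattD opprD addrA [in RHS]mulmxBr invB_latt.
apply: eq_has_sum (has_sumZ (c := (s ^+ 2)%:C) h) => p.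
by rewrite /dilM conjc_scale [RHS]mulrACA -rmorphM.
Qed.

Lemma l2_dilM xi : l2 xi -> l2 (dilM xi).
Proof.
move=> xl2 t.
exists (s ^+ 2 * \sum_(c < N) sqn xi (invmx B *m (t - latt R (w c)))).
rewrite rmorphM raddf_sum.
under eq_bigr do rewrite /= -innerxx //.
by apply: eq_has_sum (has_sum_dilM (t := t) xl2 xl2) => p; rewrite conj_mul.
Qed.

Lemma inner_dilM_eq0 xi eta : l2 xi -> l2 eta -> inner xi eta = 0 ->
  inner (dilM xi) (dilM eta) = 0.
Proof.
move=> xl2 el2 xe; apply/funext => t.
rewrite (innerE (has_sum_dilM (t := t) xl2 el2)) big1 ?mulr0 // => c _.
by rewrite xe.
Qed.

End Cosets.

Lemma dilM_mul xi f t : dilM (xi * f) t = dilM xi t * f (invmx B *m t).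
Proof. by rewrite /dilM mulrA. Qed.

Variables (N N' : nat) (v w : nat -> 'cV[int]_n).
Hypotheses (vM : repr_sys M N v) (wM : repr_sys M^T N' w) (sN : s ^+ 2 * N%:R = 1).

(** The conjugated character at [t - p], times the outer weight, leaves [e(-v_l . B^-1 p)]. Summing
    over [l] keeps only [p] in the image of [M^T], with weight [N], and [s ^+ 2 * N = 1] normalises
    what remains. *)
Lemma polyphase xi eta t : l2 xi -> l2 eta ->
  \sum_(l < N) chi (v l) (invmx B *m t) * inner (dilM (xi * chi (v l))) (dilM eta) t =
  inner xi eta (invmx B *m t).
Proof.
move=> xl2 el2.
pose a p := conjc (dilM xi (t - latt R p)) * dilM eta (t - latt R p).
have Dl2 f := l2_dilM wM (xi := f).
have h l : has_sum (fun p => e (- pairing (v l) (invmx B *m latt R p)) * a p)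
   (chi (v l) (invmx B *m t) * inner (dilM (xi * chi (v l))) (dilM eta) t).
  have xcl2 : l2 (xi * chi (v l)) by apply: l2M => //; exact/CT_periodic/CT_chi.
  apply: eq_has_sum (has_sumZ (inner_has_sum (Dl2 _ xcl2) (Dl2 _ el2))) => p.
  have E : conjc (dilM (xi * chi (v l)) (t - latt R p)) =
      conjc (dilM xi (t - latt R p)) * e (pairing (v l) (invmx B *m (t - latt R p))).
    by rewrite dilM_mul -[in RHS](opprK (pairing _ _)) eN -rmorphM.
  rewrite E /chi mulmxBr pairingDr pairingNr eD /a.
  have c : e (- pairing (v l) (invmx B *m t)) * e (pairing (v l) (invmx B *m t)) = 1.
    by rewrite -eD addNr e0.
  by rewrite -[RHS]mul1r -c; ring.
have := has_sum_bigD (r := index_enum 'I_N)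
  (f := fun l p => e (- pairing (v l) (invmx B *m latt R p)) * a p) h.
move/has_sum_unique; apply.
apply: (has_sum_inj (h := mulmx M^T)).
- by apply: mulmx_int_inj; rewrite det_tr.
- move=> p np; rewrite -mulr_suml char_sum //.
  by case: asboolP => [[q pE]|_]; [case: np; exists q|rewrite mul0r].
apply: eq_has_sum (inner_has_sum (t := invmx B *m t) xl2 el2) => q.
rewrite -mulr_suml char_sum //; case: asboolP => [_|np]; last by case: np; exists q.
rewrite /a /dilM !mulmxBr invB_latt conjc_scale mulrACA -rmorphM -expr2 [RHS]mulrA.
rewrite (_ : N%:R * _ = 1) ?mul1r //.
by rewrite -(rmorph_nat (real_complex R)) -rmorphM mulrC sN.
Qed.

(** Taken out of the dilation, [chi (v l)] becomes exactly the weight in [polyphase]. *)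
Lemma dilM_reconstruct psi xi eta t : l2 xi -> l2 eta ->
  \sum_(l < N) dilM (psi * chi (v l)) t * inner (dilM (xi * chi (v l))) (dilM eta) t =
  dilM (psi * inner xi eta) t.
Proof.
move=> xl2 el2; rewrite dilM_mul -polyphase // mulr_sumr; apply: eq_bigr => l _.
by rewrite dilM_mul mulrA.
Qed.

Lemma inner_dilM_eq0_inv xi eta : l2 xi -> l2 eta ->
  (forall l : nat, inner (dilM (xi * chi (v l))) (dilM eta) = 0) -> inner xi eta = 0.
Proof.
move=> xl2 el2 h; apply/funext => t.
rewrite -[t](mulKmx unitB) -polyphase // big1 // => l _.
by rewrite h mulr0.
Qed.

End Dilation.

(** * Module frames *)

Section Frames.
Variables (R : realType) (n : nat).
Notation F := ('cV[R]_n -> R[i]).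
Implicit Types (xi eta zeta f : F) (t u : 'cV[R]_n) (p q : 'cV[int]_n) (X : set F).

Lemma modnorm_ge0 xi : (0 <= modnorm xi)%E.
Proof. exact: poweR_ge0. Qed.

Lemma modnorm_cvg0 (I : choiceType) (y : {fset I} -> F) :
  (forall eps : R, 0 < eps -> exists J0 : {fset I}, forall J : {fset I},
    (J0 `<=` J)%fset -> (modnorm (y J) <= eps%:E)%E) ->
  modnorm (y J) @[J --> @totally I] --> (0 : \bar R)%E.
Proof.
move=> H; apply/fine_cvgP; split.
  have [J0 HJ] := H 1 ltr01.
  exists J0 => // J /HJ h; rewrite ge0_fin_numE ?modnorm_ge0 //.
  by rewrite (le_lt_trans h) // ltry.
apply/cvgrPdist_le => eps e0; have [J0 HJ] := H eps e0.
exists J0 => // J /HJ h /=.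
rewrite sub0r normrN ger0_norm ?fine_ge0 ?modnorm_ge0 //.
rewrite -lee_fin fineK // ge0_fin_numE ?modnorm_ge0 //.
by rewrite (le_lt_trans h) // ltry.
Qed.

Lemma modnorm0 : modnorm (0 : F) = 0%E.
Proof.
apply/eqP; rewrite eq_le modnorm_ge0 andbT.
apply: l2_modnorm => // [|t]; first exact: l2_0.
rewrite (sqnE (s := 0)) ?expr0n //.
apply: eq_has_sum (@has_sum0 _ _) => p.
by rewrite (_ : (0 : F) _ = 0) // Normc.normc0 expr0n.
Qed.

Lemma modnorm_eq0 xi : modnorm xi = 0%E -> xi = 0.
Proof.
move=> x0; have [|xl2 xs] := @modnorm_l2 R n xi 0 (lexx _); first by rewrite x0.
by apply: sqn_eq0 => // t; rewrite (le_trans (xs t)) // expr0n.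
Qed.

Definition reconstructs (I : finType) X (psi : I -> F) : Prop :=
  (forall k, X (psi k)) /\
  forall xi, X xi -> xi = \sum_k psi k * inner (psi k) xi.

Lemma partial_sum_full (I : finType) (V : zmodType) (x : I -> V) (J : {fset I}) :
  (forall i, i \in J) -> partial_sum x J = \sum_i x i.
Proof.
move=> Jfull; rewrite /partial_sum -(big_seq_fsetE _ J xpredT x); apply/perm_big/uniq_perm.
- exact: fset_uniq.
- exact: index_enum_uniq.
- by move=> i; rewrite mem_index_enum; exact: Jfull.
Qed.

(** The net of partial sums is constant from the full index set on, and a function of norm 0
    vanishes; convergence is thus an exact formula. *)
Lemma finite_frameP (I : finType) X (psi : I -> F) : X `<=` @Xi R n ->
  module_frame X psi <-> reconstructs X psi.
Proof.
move=> XXi; pose J0 : {fset I} := [fset i | i in I]%fset.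
have J0full (J : {fset I}) : (J0 `<=` J)%fset -> forall i, i \in J.
  by move=> /fsubsetP J0J i; apply: J0J; apply/imfsetP; exists i.
split=> -[Xpsi H]; split=> // xi Xxi; have := H xi Xxi.
  set S := \sum_k _ => lim0.
  have limc : modnorm (xi - partial_sum (fun k => psi k * inner (psi k) xi) J)
      @[J --> @totally I] --> modnorm (xi - S).
    apply: cvg_near_cst; exists J0 => // J /J0full Jfull.
    by rewrite partial_sum_full.
  have : 0%E = modnorm (xi - S) by exact: (cvg_unique (@ereal_hausdorff R) lim0 limc).
  by move/esym/modnorm_eq0/eqP; rewrite subr_eq0 => /eqP.
move=> xiE; apply: modnorm_cvg0 => eps e0; exists J0 => J /J0full Jfull.
by rewrite partial_sum_full // {1}xiE subrr modnorm0 lee_fin ltW.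
Qed.

Lemma submodule_l2 X xi : is_submodule X -> X xi -> l2 xi.
Proof. by move=> [XXi _ _ _] /XXi; exact: l2_Xi. Qed.

Lemma submodule_sum X (L : Type) (r : seq L) (f : L -> F) :
  is_submodule X -> (forall k, X (f k)) -> X (\sum_(k <- r) f k).
Proof. by move=> [_ X0 XD _] Xf; elim/big_ind: _. Qed.

(** The coefficient map into the free module has the synthesis map as retraction: that is the
    reconstruction formula. *)
Lemma reconstructs_fg_projective (I : finType) X (psi : I -> F) :
  is_submodule X -> reconstructs X psi -> is_fg_projective X.
Proof.
move=> Xsub [Xpsi rec]; have [XXi X0 XD XM] := Xsub.
have Xl2 xi : X xi -> l2 xi by exact: submodule_l2.
pose phi (k : 'I_#|I|) := psi (enum_val k).
have Xphi k : X (phi k) by exact: Xpsi.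
exists #|I|, (fun xi k => inner (phi k) xi), (fun a => \sum_k phi k * a k); split.
- split=> [xi Xxi k|xi eta Xxi Xeta|f xi fCT Xxi].
  + by apply: CT_inner; apply: XXi => //; exact: Xphi.
  + by apply/funext => k; rewrite innerDr //; apply: Xl2 => //; exact: Xphi.
  + apply/funext => k; rewrite innerMr //; [exact: CT_periodic|exact/Xl2/Xphi|exact: Xl2].
- split=> [a aCT|a b aCT bCT|f a fCT aCT].
  + by apply: submodule_sum => // k; apply: XM.
  + by rewrite -big_split; apply: eq_bigr => k _ /=; rewrite -mulrDr.
  + by rewrite /= mulr_suml; apply: eq_bigr => k _; rewrite -mulrA.
- move=> xi Xxi; rewrite [RHS](rec _ Xxi) [RHS](reindex (@enum_val I I)) //.
  exact/onW_bij/enum_val_bij.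
Qed.

End Frames.

(** * Projective multiresolution analyses *)

Lemma trmx_expr (K : comPzRingType) n (A : 'M[K]_n) i : (A ^+ i)^T = A^T ^+ i.
Proof.
elim: i => [|i IH]; first by rewrite !expr0 trmx1.
by rewrite exprS -mulmxE trmx_mul IH mulmxE -exprSr.
Qed.

Lemma invmx_mul (K : comUnitRingType) n (B C : 'M[K]_n) :
  B \in unitmx -> C \in unitmx -> invmx (B *m C) = invmx C *m invmx B.
Proof.
move=> uB uC; have uBC : B *m C \in unitmx by rewrite unitmx_mul uB.
by apply: (can_inj (mulKmx uBC)); rewrite mulmxV // mulmxA mulmxK // mulmxV.
Qed.

Section PMRA.
Variables (R : realType) (n : nat) (A : 'M[int]_n) (d : nat).
Notation F := ('cV[R]_n -> R[i]).
Implicit Types (xi eta zeta f : F) (t u : 'cV[R]_n) (p q : 'cV[int]_n) (X : set F).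
Hypotheses (d1 : (1 < d)%N) (hd : d = `|\det A|%N).

Lemma detA_neq0 : \det A != 0.
Proof. by rewrite -absz_eq0 -hd; case: d d1. Qed.

Lemma detAX_neq0 i : \det (A ^+ i) != 0.
Proof.
elim: i => [|i IH]; first by rewrite expr0 det1.
by rewrite exprS -mulmxE det_mulmx mulf_neq0 // detA_neq0.
Qed.

Definition dilX i : F -> F := dilM (A ^+ i) ((sqrtdet R A)^-1 ^+ i).

Lemma iter_dil i : iter i (@dil R n A) = dilX i.
Proof.
apply/funext => xi; elim: i => [|i IH]; apply/funext => t.
  by rewrite /dilX /dilM !expr0 mul1r /Defs.realmx map_mx1 trmx1 invmx1 mul1mx.
rewrite iterS IH /dil /dilX /dilM mulrA -rmorphM -exprS mulmxA.
congr (_ * xi (_ *m _)).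
rewrite -invmx_mul ?unitB ?detAX_neq0 ?detA_neq0 //.
by rewrite -trmx_mul exprSr -mulmxE /Defs.realmx map_mxM.
Qed.

(** The normalisation [s ^+ 2 * N = 1] demanded by [polyphase], at level [i]. *)
Lemma sqrtdet_expr i : ((sqrtdet R A)^-1 ^+ i) ^+ 2 * (d ^ i)%:R = 1.
Proof.
rewrite exprAC [_ ^-1 ^+ 2]exprVn /sqrtdet sqr_sqrtr ?normr_ge0 // det_map_mx.
rewrite -intr_norm -abszE -hd natrX -exprMn mulVf ?expr1n //.
by rewrite pnatr_eq0; case: d d1.
Qed.

(** * The spaces of the analysis and their wavelet spaces *)

Variables (V : int -> set F) (hV : is_pmra A V).

Lemma pmra_dilP (i : nat) xi : V i xi <-> exists2 zeta, V 0 zeta & xi = dilX i zeta.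
Proof.
rewrite (pmra_dil hV i%:Z) /= iter_dil; split.
  by case=> zeta ? <-; exists zeta.
by case=> zeta ? ->; exists zeta.
Qed.

(** Multiplying a dilate by [f] amounts to multiplying the undilated function by [f] composed with
    the transpose of [A ^+ i], again in [CT]. *)
Lemma pmra_submodule (i : nat) : is_submodule (V i).
Proof.
have [VXi V0 VD _] := pmra_subspace hV i; split=> // f xi fCT.
case/pmra_dilP => zeta Vz ->; apply/pmra_dilP.
exists (zeta * (fun t => f ((Defs.realmx R (A ^+ i))^T *m t))).
  by have [_ _ _ V0M] := pmra_submodule0 hV; apply: V0M => //; exact: CT_mulmx.
apply/funext => t; rewrite /dilX dilM_mul mulKVmx //.
exact/unitB/detAX_neq0.
Qed.

Lemma pmra_incr (i j : nat) : (i <= j)%N -> V i `<=` V j.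
Proof.
move=> /subnKC <-; elim: (j - i)%N => [|k IH]; first by rewrite addn0.
by apply: subset_trans IH _; rewrite addnS -[(i + k).+1]addn1 PoszD; exact: (pmra_incl hV).
Qed.

Local Notation W := (wavelet_space V).

Lemma pmra_l2 (i : nat) xi : V i xi -> l2 xi.
Proof. exact/submodule_l2/pmra_submodule. Qed.

Lemma wavelet_submodule i : is_submodule (W i).
Proof.
have [VXi V0 VD VM] := pmra_submodule i.+1; split.
- by move=> xi [/VXi].
- by split=> // eta _; exact: innerr0.
- move=> xi eta [Vxi xiV] [Veta etaV]; split; first exact: VD.
  move=> zeta Vz; rewrite innerDr ?(xiV, etaV) ?addr0 //.
  + exact: pmra_l2 Vz.
  + exact: pmra_l2 Vxi.
  + exact: pmra_l2 Veta.
- move=> f xi fCT [Vxi xiV]; split; first exact: VM.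
  move=> zeta Vz; rewrite innerMr ?xiV ?mul0r //.
  + exact: CT_periodic.
  + exact: pmra_l2 Vz.
  + exact: pmra_l2 Vxi.
Qed.

Lemma wavelet_l2 i xi : W i xi -> l2 xi.
Proof. exact/submodule_l2/wavelet_submodule. Qed.

Variables (v w : nat -> 'cV[int]_n).
Hypotheses (vA : forall i, repr_sys (A ^+ i) (d ^ i) v)
  (wA : forall i, repr_sys (A^T ^+ i) (d ^ i) w).

Lemma wAT i : repr_sys (A ^+ i)^T (d ^ i) w.
Proof. by rewrite trmx_expr. Qed.

Lemma wavelet_dilP i xi : W i xi <-> exists2 zeta, W 0 zeta & xi = dilX i zeta.
Proof.
have shift zeta : dilX i.+1 zeta = dilX i (dilX 1 zeta).
  by rewrite -!iter_dil -iterD addn1.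
split.
- case=> /pmra_dilP[zeta0 Vz ->] ort; exists (dilX 1 zeta0); last exact: shift.
  have V1 : V 1%:Z (dilX 1 zeta0) by apply/pmra_dilP; exists zeta0.
  split=> // eta Veta.
  (* [V 0] is stable under characters, so the orthogonality hypothesis covers the dilates of all
     [eta * chi (v l)], as the inversion requires. *)
  apply: (inner_dilM_eq0_inv (detAX_neq0 i) (vA i) (wAT i) (sqrtdet_expr i)).
  + exact: pmra_l2 Veta.
  + exact: pmra_l2 V1.
  + move=> l; rewrite -/(dilX i _) -/(dilX i _) -shift; apply: ort.
    apply/pmra_dilP; exists (eta * chi (v l)) => //.
    have [_ _ _ VM] := pmra_submodule 0; apply: VM => //; exact: CT_chi.
- case=> zeta [V1 ort] ->; split.
    case/pmra_dilP: V1 => zeta0 Vz ->; apply/pmra_dilP; exists zeta0 => //.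
  move=> eta /pmra_dilP[eta0 Veta ->].
  apply: (inner_dilM_eq0 _ (detAX_neq0 i) (wAT i)).
  + exact: pmra_l2 Veta.
  + exact: pmra_l2 V1.
  + exact: ort.
Qed.

Variables (r : nat) (Psi : 'I_r -> F).
Hypothesis hPsi : reconstructs (W 0) Psi.

Local Notation level := (fun i => @level_family R n A d r v Psi i).

Lemma levelE i lk : level i lk = dilX i (Psi lk.2 * chi (v lk.1)).
Proof. by rewrite /level_family /= iter_dil eps_opE. Qed.

Lemma level_reconstructs i : reconstructs (W i) (level i).
Proof.
have [WPsi rec] := hPsi.
split=> [[l k]|xi /wavelet_dilP[zeta Wz ->]].
  rewrite levelE; apply/wavelet_dilP; exists (Psi k * chi (v l)) => //.
  by have [_ _ _ WM] := wavelet_submodule 0; apply: WM; [exact: CT_chi|exact: WPsi].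
have zl2 := wavelet_l2 Wz; have Pl2 k := wavelet_l2 (WPsi k).
apply/funext => t; rewrite fct_sumE.
pose G l k := dilX i (Psi k * chi (v l)) t * inner (dilX i (Psi k * chi (v l))) (dilX i zeta) t.
transitivity (\sum_(lk : 'I_(d ^ i) * 'I_r) G lk.1 lk.2); last first.
  by apply: eq_bigr => lk _; rewrite /G -levelE.
(* For fixed [k] the sum over [l] collapses to the dilate of [Psi k * inner (Psi k) zeta]; the sum
   over [k] is then the formula of [W 0]. *)
rewrite -(pair_bigA _ (fun (l : 'I_(d ^ i)) k => G l k)) exchange_big /=.
under eq_bigr => k _.
  rewrite (dilM_reconstruct (detAX_neq0 i) (vA i) (wAT i) (sqrtdet_expr i)) //; over.
by rewrite {1}(rec _ Wz) /dilX /dilM fct_sumE mulr_sumr.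
Qed.

Lemma wavelet_fg_projective i : is_fg_projective (W i).
Proof. exact: reconstructs_fg_projective (wavelet_submodule i) (level_reconstructs i). Qed.

(** * The combined family and its finite partial reconstructions *)

Variables (s : nat) (Phi : 'I_s -> F).
Hypothesis hPhi : reconstructs (V 0) Phi.

Local Notation idx := ('I_s + {j : nat & ('I_(d ^ j) * 'I_r)%type})%type.
Local Notation full := (full_family A v Phi Psi : idx -> F).

(** Selects the members of the family lying in [V m]: a level [j < m] lies in [V (j + 1)]. Members
    of the other levels are orthogonal to [V m]. *)
Definition below (m : nat) (x : idx) : bool :=
  if x is inr y then (tag y < m)%N else true.

Lemma full_in_V m x : below m x -> V m (full x).
Proof.
case: x => [k _|[j lk] /= jm]; first by apply: (pmra_incr (leq0n m)); exact: hPhi.1.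
by apply: (pmra_incr jm); case: ((level_reconstructs j).1 lk).
Qed.

Lemma full_l2 x : l2 (full x).
Proof.
case: x => [k|[j lk]]; first exact/(pmra_l2 (i := 0))/hPhi.1.
exact/(wavelet_l2 (i := j))/(level_reconstructs j).1.
Qed.

Lemma full_orth m x xi : ~~ below m x -> V m xi -> inner (full x) xi = 0.
Proof.
case: x => // -[j lk] /=; rewrite -leqNgt => mj Vxi.
have [_ ort] := (level_reconstructs j).1 lk.
apply: inner0_sym; [exact: pmra_l2 Vxi|exact: (full_l2 (inr (existT _ j lk)))|].
exact/ort/(pmra_incr mj).
Qed.

Definition frame_sum (J : {fset idx}) xi : F :=
  \sum_(x <- J) full x * inner (full x) xi.

Lemma l2_frame_term x xi : l2 xi -> l2 (full x * inner (full x) xi).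
Proof. by move=> xl2; apply: l2M (full_l2 x); apply: inner_periodic => //; exact: full_l2. Qed.

Lemma l2_frame_sum J xi : l2 xi -> l2 (frame_sum J xi).
Proof. by move=> xl2; apply: l2_sum => x; exact: l2_frame_term. Qed.

Lemma frame_sumB J xi eta : l2 xi -> l2 eta ->
  frame_sum J (xi - eta) = frame_sum J xi - frame_sum J eta.
Proof.
move=> xl2 el2; rewrite /frame_sum -sumrB; apply: eq_bigr => x _.
by rewrite innerBr ?mulrBr //; exact: full_l2.
Qed.

Lemma inner_frame_sum J xi eta t : l2 xi -> l2 eta ->
  inner eta (frame_sum J xi) t =
  \sum_(x <- J) conjc (inner (full x) eta t) * inner (full x) xi t.
Proof.
move=> xl2 el2; rewrite inner_sumr //; last by move=> x; exact: l2_frame_term.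
rewrite fct_sumE; apply: eq_bigr => x _; have fx := full_l2 x.
rewrite (innerMr (inner_periodic fx xl2) el2 fx) -(inner_conj t fx el2).
reflexivity.
Qed.

Lemma frame_sum_in_V m J xi : Xi xi -> (forall x, x \in J -> below m x) ->
  V m (frame_sum J xi).
Proof.
move=> xX Jm; have [VXi V0 VD VM] := pmra_submodule m.
rewrite /frame_sum big_seq; elim/big_ind: _ => // x xJ.
have Vx := full_in_V (Jm _ xJ).
by apply: VM => //; apply: CT_inner => //; exact: VXi.
Qed.

Definition is_frame_of m (B : {fset idx}) : Prop :=
  (forall x, (x \in B) = below m x) /\ forall xi, V m xi -> xi = frame_sum B xi.

(** Reconstruct [eta] and move the sum to the other side. The error [xi - frame_sum B xi] is thus
    orthogonal to [V m]. *)
Lemma inner_projection m B xi eta : is_frame_of m B -> l2 xi -> V m eta ->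
  inner eta (frame_sum B xi) = inner eta xi.
Proof.
move=> [_ rec] xl2 Veta; have el2 := pmra_l2 Veta; apply/funext => t.
rewrite inner_frame_sum // [in RHS](rec _ Veta).
rewrite (inner_conj t xl2 (l2_frame_sum B el2)) inner_frame_sum // rmorph_sum.
by apply: eq_bigr => x _; rewrite rmorphM /= conjcK mulrC.
Qed.

(** Induction on [m]: for [xi] in [V m.+1], the error [xi'] of the reconstruction by [B] lies in
    [W m], where level [m] reconstructs it. *)
Lemma exists_frame_of m : exists B, is_frame_of m B.
Proof.
elim: m => [|m [B [Bm rec]]].
  exists [fset (inl k : idx) | k in [set: 'I_s]%SET]%fset; split.
    case=> [k|[j lk]] /=; first by apply/imfsetP; exists k => //=; rewrite inE.
    by apply/negbTE/imfsetP => -[].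
  move=> xi Vxi; rewrite /frame_sum big_imfset /=; last by move=> k k' _ _ [].
  rewrite {1}(hPhi.2 _ Vxi); apply/esym.
  by rewrite big_enum; apply: eq_bigl => k; rewrite inE.
pose h lk : idx := inr (existT (fun j => ('I_(d ^ j) * 'I_r)%type) m lk).
pose C : {fset idx} := [fset h lk | lk in [set: 'I_(d ^ m) * 'I_r]%SET]%fset.
have inC x : (x \in C) = if x is inr y then tag y == m else false.
  case: x => [k|[j lk]]; first by apply/negbTE/imfsetP => -[].
  apply/imfsetP/eqP => /= [[lk' _ []] //|jm].
  by subst j; exists lk; rewrite //= inE.
exists (B `|` C)%fset; split.
  move=> x; rewrite inE Bm inC; case: x => //= -[j lk] /=.
  by rewrite ltnS [RHS]leq_eqVlt orbC.
move=> xi Vxi; have xl2 := pmra_l2 Vxi.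
have [VXi V0 VD VM] := pmra_submodule m.+1.
pose xi' := xi - frame_sum B xi.
have Bxi : V m (frame_sum B xi).
  by apply: frame_sum_in_V => [|x]; [exact: VXi | rewrite Bm].
have Wxi : W m xi'.
  split.
    apply: VD => //; have [_ _ _ VZ] := pmra_subspace hV m.+1.
    have := VZ (-1) _ (pmra_incr (leqnSn m) Bxi).
    by congr (V _ _); apply/funext => t; rewrite [LHS]mulrN1.
  move=> eta Veta; have el2 := pmra_l2 Veta; have Sl2 := l2_frame_sum B xl2.
  by rewrite innerBr // (inner_projection (conj Bm rec) xl2 Veta) subrr.
rewrite /frame_sum (big_fsetID _ (mem B)) /=.
rewrite [X in X + _](_ : _ = frame_sum B xi); last first.
  by apply: eq_fbigl => x; rewrite !inE /=; case: (x \in B); rewrite ?andbF.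
rewrite [X in _ + X](_ : _ = frame_sum C xi); last first.
  apply: eq_fbigl => x; rewrite !inE /=; have := Bm x; have := inC x.
  case: x => [k|[j lk]] /=; first by move=> -> ->.
  by move=> -> ->; case: eqP => [->|_]; rewrite ?ltnn ?orbT ?orbF ?andbN.
rewrite -[LHS](subrK (frame_sum B xi)) addrC; congr (_ + _).
rewrite [RHS]/frame_sum -/xi' {1}((level_reconstructs m).2 _ Wxi) big_imfset /=; last first.
  by move=> lk lk' _ _ [] /eqP; rewrite -tag_eqE /tag_eq /= eqxx tagged_asE => /eqP.
rewrite [RHS]big_enum; apply: eq_big => [lk|lk _]; first by rewrite inE.
(* The coefficients of [xi'] at level [m] are those of [xi], since level [m] is orthogonal to
   [frame_sum B xi], an element of [V m]. *)
rewrite innerBr //; [|exact: (full_l2 (h lk))|exact: l2_frame_sum].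
rewrite [X in _ - X](_ : _ = 0) ?subr0 //.
by apply: (full_orth (x := h lk) _ Bxi); rewrite /= ltnn.
Qed.

(* Holds on Xi and is clearly stable under differences, which avoids proving
   that the completion Xi is itself a subspace. *)
Definition tame xi : Prop := l2 xi /\
  forall m J, (forall x, x \in J -> below m x) -> V m (frame_sum J xi).

Lemma tame_Xi xi : Xi xi -> tame xi.
Proof. by move=> xX; split=> [|m J]; [exact: l2_Xi|exact: frame_sum_in_V]. Qed.

Lemma pmraB (m : nat) xi eta : V m xi -> V m eta -> V m (xi - eta).
Proof.
move=> Vx Ve; have [_ _ VD VZ] := pmra_subspace hV m; apply: VD => //.
have := VZ (-1) _ Ve; congr (V _ _).
by apply/funext => t; rewrite [LHS]mulrN1.
Qed.

Lemma tameB xi eta : tame xi -> tame eta -> tame (xi - eta).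
Proof.
move=> [xl2 xV] [el2 eV]; split; first exact: l2B.
by move=> m J Jm; rewrite frame_sumB //; apply: pmraB; [exact: xV|exact: eV].
Qed.

(** * Bessel's inequality and convergence on [Xi] *)

Definition energy (J : {fset idx}) xi t : R :=
  \sum_(x <- J) Normc.normc (inner (full x) xi t) ^+ 2.

Lemma exists_below (J : {fset idx}) : exists m, forall x, x \in J -> below m x.
Proof.
(* The successor is there because [below] asks for a level strictly less than [m]. *)
pose rank (x : idx) := if x is inr y then (tag y).+1 else 0%N.
exists (\max_(x <- J) rank x)%N => x xJ.
have := leq_bigmax_seq (P := xpredT) (F := rank) x xJ isT.
by case: x {xJ}.
Qed.

(** Enlarge [J] to all indices [B] below some [m]. For the projection [P = frame_sum B xi] the
    energy is [<P, P>], and [0 <= <xi - P, xi - P> = <xi, xi> - <P, P>]. *)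
Lemma bessel J xi t : tame xi -> energy J xi t <= sqn xi t.
Proof.
move=> [xl2 xV]; have [m Jm] := exists_below J.
have [B BP] := exists_frame_of m; have [Bm rec] := BP.
have JB : (J `<=` B)%fset by apply/fsubsetP => x /Jm; rewrite Bm.
apply: (@le_trans _ _ (energy B xi t)).
  by apply: ler_sum_fset => // x; exact: sqr_ge0.
pose P := frame_sum B xi.
have VP : V m P by apply: xV => x; rewrite Bm.
have Pl2 := pmra_l2 VP.
have PP : inner P P = inner P xi by exact: inner_projection.
have xP : inner xi P = inner P P.
  apply/funext => u; rewrite (inner_conj u Pl2 xl2) -PP.
  by rewrite innerxx // conjc_real.
have eP : energy B xi t = sqn P t.
  apply: complexI; rewrite -innerxx // -xP inner_frame_sum // raddf_sum.
  by apply: eq_bigr => x _; rewrite conj_mul.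
have : 0 <= sqn (xi - P) t by apply/sqn_ge0/l2B.
rewrite eP -lecR -innerxx; last exact: l2B.
rewrite innerBr //; last exact: l2B.
rewrite [X in _ <= X](_ : _ = inner (xi - P) xi t - inner (xi - P) P t) //.
have nPl2 := l2N Pl2.
rewrite !innerDl // [X in _ <= X](_ : _ = (inner xi xi t + inner (- P) xi t) -
  (inner xi P t + inner (- P) P t)) //.
by rewrite !innerNl // xP -PP subrr subr0 !innerxx // -rmorphB lecR subr_ge0.
Qed.

(** For [u = frame_sum J xi], expanding [<u, u>] bounds it by half the sum of the energies of [u]
    and [xi]. Bessel for both gives [<u, u> <= (<u, u> + <xi, xi>) / 2]. *)
Lemma sqn_frame_sum_le J xi t : tame xi -> sqn (frame_sum J xi) t <= sqn xi t.
Proof.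
move=> xT; have [xl2 xV] := xT; have [m Jm] := exists_below J.
pose u := frame_sum J xi.
have [VXi _ _ _] := pmra_submodule m.
have uT : tame u by apply/tame_Xi/VXi/xV.
have ul2 := uT.1.
have : (sqn u t)%:C <= ((energy J u t + energy J xi t) / 2)%:C.
  rewrite -innerxx // -[leLHS]ger0_norm; last by rewrite innerxx // ler0c sqn_ge0.
  rewrite [X in `|X|]inner_frame_sum // (le_trans (ler_norm_sum _ _ _)) //.
  rewrite -big_split /= mulr_suml raddf_sum; apply: ler_sum => x _.
  rewrite normrM normcJ !norm_normc -rmorphM lecR /=.
  move: (Normc.normc _) (Normc.normc _) => b a.
  have := sqr_ge0 (a - b); lra.
rewrite lecR; have := bessel J t uT; have := bessel J t xT; rewrite -/u; lra.
Qed.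

Lemma full_module_frame : module_frame (@Xi R n) full.
Proof.
split=> [[k|[j lk]]|xi xX].
- have [VXi _ _ _] := pmra_submodule 0; exact/VXi/hPhi.1.
- have [WXi _ _ _] := wavelet_submodule j; exact/WXi/(level_reconstructs j).1.
apply: modnorm_cvg0 => eps e0.
(* Two terms of square norm at most [(eps / 2) ^+ 2] and the factor 2 in [sqnD_le] give exactly
   [eps ^+ 2]. *)
have e2 : 0 < eps / 2 by rewrite divr_gt0.
have [m [eta [Veta /ltW xe]]] := pmra_dense hV xX e2.
have [_ xeS] := modnorm_l2 (ltW e2) xe.
have [B [Bm rec]] := exists_frame_of m.
have [VXi _ _ _] := pmra_submodule m.
have xT := tame_Xi xX; have eT := tame_Xi (VXi _ Veta); have xeT := tameB xT eT.
exists B => J BJ.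
(* Indices of [J] outside [B] have coefficient 0 on [eta], by orthogonality to [V m]. *)
have etaE : frame_sum J eta = eta.
  rewrite {2}(rec _ Veta); apply/esym/(big_fset_incl _ BJ) => x _ xB.
  by rewrite (full_orth (m := m)) ?mulr0 // -Bm.
have -> : partial_sum (fun x => full x * inner (full x) xi) J = frame_sum J xi.
  by rewrite /partial_sum -(big_seq_fsetE _ J xpredT (fun x => full x * inner (full x) xi)).
(* As [frame_sum J] fixes [eta], the error depends only on the small function [xi - eta]. *)
have -> : xi - frame_sum J xi = (xi - eta) - frame_sum J (xi - eta).
  rewrite frame_sumB ?etaE; [|exact: xT.1|exact: eT.1].
  by rewrite opprB addrA subrK.
have Sl2 := l2_frame_sum J xeT.1.
apply: l2_modnorm => [||t]; [exact: ltW|by apply: l2B => //; exact: xeT.1|].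
apply: le_trans (sqnD_le t xeT.1 (l2N Sl2)) _.
rewrite sqnN //; have := sqn_frame_sum_le J t xeT; have := xeS t.
rewrite expr_div_n; lra.
Qed.

End PMRA.

Theorem theorem5p1 (R : realType) (n : nat) (hn : (2 <= n)%N)
    (A : 'M[int]_n)
    (hGL : (map_mx intr A : 'M[rat]_n) \in unitmx)
    (hA : is_dilation R A)
    (d : nat) (hd : d = `|\det A|%N)
    (V : int -> set ('cV[R]_n -> R[i])) (hV : is_pmra A V)
    (s : nat) (Phi : 'I_s -> 'cV[R]_n -> R[i])
    (hPhi : module_frame (V 0) Phi)
    (r : nat) (Psi : 'I_r -> 'cV[R]_n -> R[i])
    (hPsi : module_frame (wavelet_space V 0) Psi) :
  exists v : nat -> 'cV[int]_n,
    [/\ injective v,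
        forall i : nat, coset_reps A d i v,
        forall i : nat,
          is_submodule (wavelet_space V i) /\
          is_fg_projective (wavelet_space V i),
        forall i : nat, (0 < i)%N ->
          module_frame (wavelet_space V i)
            (@level_family R n A d r v Psi i)
      & module_frame (@Xi R n) (@full_family R n A d s r v Phi Psi)].
Proof.
have d1 : (1 < d)%N by rewrite hd; apply: dilation_det_gt1 hA; exact: ltnW.
have [v [v_inj vA]] := exists_nested_reprs d1 hd.
(* Sums over the lattice are split along the image of the transpose of [A ^+ i], which needs its own
   representatives. *)
have [|w [_ wA]] := @exists_nested_reprs n A^T d d1; first by rewrite det_tr.
have Wsub i := wavelet_submodule d1 hd hV i.
have Psi_rec : reconstructs (wavelet_space V 0) Psi.
  by apply/finite_frameP => //; case: (Wsub 0).
have Phi_rec : reconstructs (V 0) Phi.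
  by apply/finite_frameP => //; case: (pmra_submodule0 hV).
exists v; split=> //.
- by move=> i; exact: repr_sys_coset_reps.
- by move=> i; split; [exact: Wsub|exact: (wavelet_fg_projective d1 hd hV vA wA Psi_rec)].
- move=> i _; apply/finite_frameP; first by case: (Wsub i).
  exact: (level_reconstructs d1 hd hV vA wA Psi_rec).
- exact: (full_module_frame d1 hd hV vA wA Psi_rec Phi_rec).
Qed.
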